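(* The first-order theory of the structure $\langle\mathbb{Q},\cdot,\leqslant\rangle$ is decidable; that is, there is an algorithm which, given a first-order sentence in the language $\{\cdot,\leqslant\}$, decides whether it is true in $\langle\mathbb{Q},\cdot,\leqslant\rangle$.
   Context: $\langle\mathbb{Q},\cdot,\leqslant\rangle$ is the first-order structure whose domain is the set of all rational numbers, with the usual multiplication and the usual (non-strict) order. *)

(* Defs.v *)
From HB Require Import structures.
From mathcomp Require Import all_boot all_order all_algebra.
From Stdlib Require Cantor.

Set Implicit Arguments.
Unset Strict Implicit.
Unset Printing Implicit Defensive.

Inductive term : Type :=
  | Var of nat
  | Mul of term & term.

Inductive formula : Type :=
  | Eqf of term & term
  | Lef of term & term
  | Notf of formula
  | Andf of formula & formula
  | Orf of formula & formula
  | Impf of formula & formula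
  | Allf of nat & formula
  | Exf of nat & formula.

Fixpoint term_vars (t : term) : seq nat :=
  match t with
  | Var x => [:: x]
  | Mul t u => term_vars t ++ term_vars u
  end.

Fixpoint free_vars (p : formula) : seq nat :=
  match p with
  | Eqf t u | Lef t u => term_vars t ++ term_vars u
  | Notf p => free_vars p
  | Andf p q | Orf p q | Impf p q => free_vars p ++ free_vars q
  | Allf x p | Exf x p => [seq y <- free_vars p | y != x]
  end.

Definition sentence (p : formula) : Prop := free_vars p = [::].

Record mul_le_structure : Type := MulLeStructure {
  carrier :> Type;
  mul_of : carrier -> carrier -> carrier;
  le_of : carrier -> carrier -> Prop
}.

Fixpoint eval (M : mul_le_structure) (e : nat -> M) (t : term) : M :=
  match t with
  | Var x => e x
  | Mul t u => mul_of (eval e t) (eval e u)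
  end.

Definition update (T : Type) (e : nat -> T) (x : nat) (a : T) : nat -> T :=
  fun y => if y == x then a else e y.

Fixpoint holds (M : mul_le_structure) (e : nat -> M) (p : formula) : Prop :=
  match p with
  | Eqf t u => eval e t = eval e u
  | Lef t u => le_of (eval e t) (eval e u)
  | Notf p => ~ holds e p
  | Andf p q => holds e p /\ holds e q
  | Orf p q => holds e p \/ holds e q
  | Impf p q => holds e p -> holds e q
  | Allf x p => forall a : M, holds (update e x a) p
  | Exf x p => exists a : M, holds (update e x a) p
  end.

Definition theory (M : mul_le_structure) (p : formula) : Prop :=
  sentence p /\ forall e : nat -> M, holds e p.

(* The total recursive functions: the least class of functions on nat that    *)
(* contains zero, successor and projections, and is closed under composition, *)
(* primitive recursion, and minimization of regular functions.  A Rocq        *)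
(* function formula -> bool would not be an adequate notion of algorithm,     *)
(* since under classical choice axioms every predicate has one.               *)
Inductive recursive : forall n : nat, (n.-tuple nat -> nat) -> Prop :=
  | recursive_zero : recursive (fun _ : 0.-tuple nat => 0)
  | recursive_succ : recursive (fun v : 1.-tuple nat => (thead v).+1)
  | recursive_proj n (i : 'I_n) : recursive (fun v : n.-tuple nat => tnth v i)
  | recursive_comp m n (f : m.-tuple nat -> nat)
      (g : 'I_m -> n.-tuple nat -> nat) :
      recursive f -> (forall i, recursive (g i)) ->
      recursive (fun v : n.-tuple nat => f [tuple g i v | i < m])
  | recursive_primrec n (f : n.-tuple nat -> nat) (g : n.+2.-tuple nat -> nat)
      (h : n.+1.-tuple nat -> nat) :
      recursive f -> recursive g ->
      (forall v : n.-tuple nat, h [tuple of 0 :: v] = f v) ->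
      (forall k (v : n.-tuple nat),
         h [tuple of k.+1 :: v] = g [tuple of k :: h [tuple of k :: v] :: v]) ->
      recursive h
  | recursive_min n (f : n.+1.-tuple nat -> nat) (h : n.-tuple nat -> nat) :
      recursive f ->
      (forall v : n.-tuple nat, f [tuple of h v :: v] = 0) ->
      (forall (v : n.-tuple nat) k, k < h v -> f [tuple of k :: v] <> 0) ->
      recursive h.

(* Goedel numbering: a constructor tag paired with the codes of the arguments *)
(* through the Cantor bijection.                                              *)
Definition pair_code (x y : nat) : nat := Cantor.to_nat (x, y).

Fixpoint term_code (t : term) : nat :=
  match t with
  | Var x => pair_code 0 x
  | Mul t u => pair_code 1 (pair_code (term_code t) (term_code u))
  end.

Fixpoint code (p : formula) : nat :=
  match p with
  | Eqf t u => pair_code 0 (pair_code (term_code t) (term_code u))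
  | Lef t u => pair_code 1 (pair_code (term_code t) (term_code u))
  | Notf p => pair_code 2 (code p)
  | Andf p q => pair_code 3 (pair_code (code p) (code q))
  | Orf p q => pair_code 4 (pair_code (code p) (code q))
  | Impf p q => pair_code 5 (pair_code (code p) (code q))
  | Allf x p => pair_code 6 (pair_code x (code p))
  | Exf x p => pair_code 7 (pair_code x (code p))
  end.

Definition decidable_theory (T : formula -> Prop) : Prop :=
  exists f : 1.-tuple nat -> nat,
    recursive f /\
    forall p : formula, sentence p ->
      (T p -> f [tuple code p] = 1) /\ (~ T p -> f [tuple code p] = 0).

Definition rat_mul_le : mul_le_structure :=
  @MulLeStructure rat (fun x y => (x * y)%R) (fun x y => (x <= y)%R).

(* Main.v *)
From mathcomp Require Import all_boot all_order all_algebra.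
From mathcomp Require Import zify ring lra.
From Stdlib Require Cantor.
From Stdlib Require Import FunctionalExtensionality.
Require Import Defs.

Set Implicit Arguments.
Unset Strict Implicit.
Unset Printing Implicit Defensive.

(* Truth in <Q, *, <=> is computed by letting quantifiers range over rationals
   of bounded height. The bounds come from an Ehrenfeucht-Fraisse argument.
   Apart from signs, two assignments a, b of positive rationals are similar if
   monomials with bounded exponents compare in the same way at a and at b, and
   if some automorphism f of the free abelian group of positive rationals sends
   each a_i to b_i up to L-th powers.  Given a value c to be matched by d:
   - if c^K is a quotient of two monomials in a, where K = M!, then a correction
     of f(c) by an L-th power has its K-th power equal to the corresponding
     quotient at b, provided f was controlled up to KL-th powers;
   - otherwise c^K only determines a cut, an open interval at b, and f(c) can be
     moved into it by a factor y^L because N-th powers are dense in Q_{>0}.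
   To bound d in the second case, f is first composed with an automorphism that
   fixes the primes occurring in b and gathers the other primes of f(c) into one
   prime, after which all exponents can be reduced modulo L.
   The resulting evaluator is primitive recursive on codes: it tabulates, along
   the codes of the subformulas, the truth value at every assignment, written as
   a number whose digits encode rationals. *)

(** * Recursive functions *)

Lemma recursive_ext n (f g : n.-tuple nat -> nat) :
  f =1 g -> recursive f -> recursive g.
Proof. by move=> /functional_extensionality->. Qed.

Definition rec1 (f : nat -> nat) := recursive (fun v : 1.-tuple nat => f (thead v)).
Definition rec2 (f : nat -> nat -> nat) :=
  recursive (fun v : 2.-tuple nat => f (tnth v ord0) (tnth v (lift ord0 ord0))).

Lemma recursive_comp1 n f (g : n.-tuple nat -> nat) :
  rec1 f -> recursive g -> recursive (fun v => f (g v)).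
Proof.
move=> rf rg; have := recursive_comp (n := n) (g := fun _ => g) rf (fun _ => rg).
by apply: recursive_ext => v; rewrite /thead tnth_mktuple.
Qed.

Lemma recursive_comp2 n f (g h : n.-tuple nat -> nat) :
  rec2 f -> recursive g -> recursive h -> recursive (fun v => f (g v) (h v)).
Proof.
move=> rf rg rh.
have := recursive_comp (n := n) (g := fun i : 'I_2 => if i == ord0 then g else h) rf.
move=> H; apply: recursive_ext (H _) => [v|i]; first by rewrite !tnth_mktuple.
by case: ifP.
Qed.

Lemma recursive_const n c : recursive (fun _ : n.-tuple nat => c).
Proof.
elim: c => [|c IH].
  have := recursive_comp (n := n) (g := fun _ _ => 0) recursive_zero.
  by apply=> -[].
exact: (recursive_comp1 (f := S) recursive_succ IH).
Qed.

Lemma rec1_id : rec1 id.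
Proof. exact: (recursive_proj ord0). Qed.

Lemma rec1_const c : rec1 (fun=> c).
Proof. exact: recursive_const. Qed.

Lemma rec1_comp f g : rec1 f -> rec1 g -> rec1 (fun x => f (g x)).
Proof. by move=> rf rg; apply: (recursive_comp1 (f := f)). Qed.

Lemma rec1_comp2 f g h :
  rec2 f -> rec1 g -> rec1 h -> rec1 (fun x => f (g x) (h x)).
Proof. by move=> rf rg rh; apply: (recursive_comp2 (f := f)). Qed.

Lemma rec2_primrec f (g : nat -> nat -> nat -> nat) :
  rec1 f ->
  recursive (fun v : 3.-tuple nat => g (tnth v (lift ord0 (lift ord0 ord0)))
    (tnth v ord0) (tnth v (lift ord0 ord0))) ->
  rec2 (fun k x => nat_rect (fun=> nat) (f x) (g x) k).
Proof.
move=> rf rg; apply: (recursive_primrec rf rg) => [v|k v].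
  by rewrite /thead !(tnth_nth 0).
by rewrite !(tnth_nth 0).
Qed.

Lemma rec2_swap f : rec2 f -> rec2 (fun x y => f y x).
Proof. by move=> rf; apply: (recursive_comp2 (f := f)) => //; apply: recursive_proj. Qed.

Lemma rec2_add : rec2 addn.
Proof.
have := @rec2_primrec id (fun _ _ a => a.+1) rec1_id.
move=> /(_ (recursive_comp1 recursive_succ (recursive_proj _))).
by apply: recursive_ext => v /=; elim: (tnth v ord0) => //= n ->.
Qed.

Lemma rec2_mul : rec2 muln.
Proof.
have := @rec2_primrec (fun=> 0) (fun x _ a => x + a) (rec1_const 0).
move=> /(_ (recursive_comp2 rec2_add (recursive_proj _) (recursive_proj _))).
by apply: recursive_ext => v /=; elim: (tnth v ord0) => //= n ->; rewrite mulSn.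
Qed.

Lemma rec1_succ : rec1 S. Proof. exact: recursive_succ. Qed.

Lemma rec1_pred : rec1 predn.
Proof.
have rp : rec2 (fun k _ => k.-1).
  have := @rec2_primrec (fun=> 0) (fun _ i _ => i) (rec1_const 0) (recursive_proj _).
  by apply: recursive_ext => v /=; case: (tnth v ord0).
exact: (rec1_comp2 rp rec1_id rec1_id).
Qed.

Lemma rec2_sub : rec2 subn.
Proof.
apply: (rec2_swap (f := fun y x => x - y)).
have := @rec2_primrec id (fun _ _ a => a.-1) rec1_id.
move=> /(_ (recursive_comp1 rec1_pred (recursive_proj _))).
by apply: recursive_ext => v /=; elim: (tnth v ord0) => /= [|n ->]; lia.
Qed.

(** * Cantor pairing and its recursive inverses *)

Definition pi1 n := (Cantor.of_nat n).1.
Definition pi2 n := (Cantor.of_nat n).2.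

Lemma pi1_pair x y : pi1 (pair_code x y) = x.
Proof. by rewrite /pi1 /pair_code Cantor.cancel_of_to. Qed.
Lemma pi2_pair x y : pi2 (pair_code x y) = y.
Proof. by rewrite /pi2 /pair_code Cantor.cancel_of_to. Qed.
Lemma pair_pi n : pair_code (pi1 n) (pi2 n) = n.
Proof. by rewrite /pi1 /pi2 /pair_code -surjective_pairing Cantor.cancel_to_of. Qed.

Lemma pair_codeE x y : pair_code x y * 2 = y * 2 + (y + x) * (y + x).+1.
Proof. by have := Cantor.to_nat_spec x y; rewrite /pair_code; lia. Qed.

Lemma pair_code_ge x y : x + y <= pair_code x y.
Proof. by have := pair_codeE x y; nia. Qed.

Lemma pair_code_le x y B : x <= B -> y <= B -> pair_code x y <= 4 * B.+1 ^ 2.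
Proof. by move=> xB yB; have := pair_codeE x y; rewrite -mulnn; nia. Qed.

(** Triangular numbers: the Cantor code of [(x, y)] is [y + tri (x + y)]. *)
Definition tri n := nat_rect (fun=> nat) 0 (fun i a => i.+1 + a) n.

Lemma triE n : tri n * 2 = n * n.+1.
Proof. by elim: n => //= n IH; rewrite mulnDl IH; lia. Qed.

Lemma rec1_nat_rect c (g : nat -> nat -> nat) :
  rec2 g -> rec1 (nat_rect (fun=> nat) c g).
Proof.
move=> rg.
have := @rec2_primrec (fun=> c) (fun _ => g) (rec1_const c).
move=> /(_ (recursive_comp2 rg (recursive_proj _) (recursive_proj _))) H.
exact: (rec1_comp2 H rec1_id rec1_id).
Qed.

Lemma rec1_tri : rec1 tri.
Proof.
apply: rec1_nat_rect.
apply: (recursive_comp2 rec2_add _ (recursive_proj _)).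
exact: (recursive_comp1 rec1_succ (recursive_proj _)).
Qed.

(* The antidiagonal x + y on which the n-th pair (x, y) lies. *)
Definition diag n :=
  nat_rect (fun=> nat) 0 (fun i a => a + (1 - (tri a.+1 - i.+1))) n.

Lemma diagE n : pi1 n + pi2 n = diag n.
Proof.
(* The pair coded by [n] lies on antidiagonal [d] exactly when [tri d <= n < tri d.+1]; the
   truncated term in [diag] adds 1 just when the next index reaches [tri a.+1]. *)
suff H m : tri (diag m) <= m < tri (diag m).+1.
  have := pair_codeE (pi1 n) (pi2 n); rewrite pair_pi => E.
  have /= := H n; have := triE (diag n); nia.
elim: m => //= m; set d := diag m; move=> /andP[/= h1 h2].
have [e|ne] := eqVneq m.+1 (d.+1 + tri d).
  have -> : 1 - (d.+1 + tri d - m.+1) = 1 by lia.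
  rewrite addn1 /=; lia.
have -> : 1 - (d.+1 + tri d - m.+1) = 0 by lia.
rewrite addn0; lia.
Qed.

Lemma rec1_diag : rec1 diag.
Proof.
apply: rec1_nat_rect; apply: (recursive_comp2 rec2_add (recursive_proj _)).
apply: (recursive_comp2 rec2_sub (recursive_const _ _)).
apply: (recursive_comp2 rec2_sub).
  exact: (recursive_comp1 rec1_tri (recursive_comp1 rec1_succ (recursive_proj _))).
exact: (recursive_comp1 rec1_succ (recursive_proj _)).
Qed.

Lemma pi2E n : pi2 n = n - tri (diag n).
Proof.
have := pair_codeE (pi1 n) (pi2 n); rewrite pair_pi -diagE.
by have := triE (pi1 n + pi2 n); nia.
Qed.

Lemma rec1_pi2 : rec1 pi2.
Proof.
have := rec1_comp2 rec2_sub rec1_id (rec1_comp rec1_tri rec1_diag).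
by apply: recursive_ext => v; rewrite pi2E.
Qed.

Lemma rec1_pi1 : rec1 pi1.
Proof.
have := rec1_comp2 rec2_sub rec1_diag rec1_pi2.
by apply: recursive_ext => v; rewrite -diagE addnK.
Qed.

Lemma rec2_pair : rec2 pair_code.
Proof.
have : rec2 (fun x y => y + tri (x + y)).
  apply: (recursive_comp2 rec2_add (recursive_proj _)).
  exact: (recursive_comp1 rec1_tri (recursive_comp2 rec2_add (recursive_proj _) (recursive_proj _))).
apply: recursive_ext => v.
have /= := pair_codeE (tnth v ord0) (tnth v (lift ord0 ord0)).
by have := triE (tnth v ord0 + tnth v (lift ord0 ord0)); nia.
Qed.

(* Functions of several arguments are reduced to unary ones on pairs: the
   context of a body is a single number, accessed by projections. *)
Lemma rec1_ext f g : f =1 g -> rec1 f -> rec1 g.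
Proof. by move=> /functional_extensionality->. Qed.

Lemma rec2P f : rec1 (fun z => f (pi1 z) (pi2 z)) <-> rec2 f.
Proof.
split=> rf; last exact: (rec1_comp2 rf rec1_pi1 rec1_pi2).
have := recursive_comp1 rf (recursive_comp2 (n := 2) rec2_pair (recursive_proj ord0)
  (recursive_proj (lift ord0 ord0))).
by apply: recursive_ext => v; rewrite pi1_pair pi2_pair.
Qed.

Lemma rec1_primrec f (g : nat -> nat -> nat -> nat) h :
  rec1 f -> rec1 h -> rec1 (fun z => g (pi1 z) (pi1 (pi2 z)) (pi2 (pi2 z))) ->
  rec1 (fun x => nat_rect (fun=> nat) (f x) (g x) (h x)).
Proof.
move=> rf rh rg.
apply: (@rec1_comp2 (fun k x => nat_rect (fun=> nat) (f x) (g x) k) h id) => //; last first.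
  exact: rec1_id.
apply: rec2_primrec => //.
have := recursive_comp1 rg (recursive_comp2 (n := 3) rec2_pair
  (recursive_proj (lift ord0 (lift ord0 ord0)))
  (recursive_comp2 rec2_pair (recursive_proj ord0) (recursive_proj (lift ord0 ord0)))).
by apply: recursive_ext => v; rewrite !pi1_pair !pi2_pair !pi1_pair.
Qed.

Lemma rec1_pair f g : rec1 f -> rec1 g -> rec1 (fun x => pair_code (f x) (g x)).
Proof. exact: rec1_comp2 rec2_pair. Qed.
Lemma rec1_add f g : rec1 f -> rec1 g -> rec1 (fun x => f x + g x).
Proof. exact: rec1_comp2 rec2_add. Qed.
Lemma rec1_mul f g : rec1 f -> rec1 g -> rec1 (fun x => f x * g x).
Proof. exact: rec1_comp2 rec2_mul. Qed.
Lemma rec1_sub f g : rec1 f -> rec1 g -> rec1 (fun x => f x - g x).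
Proof. exact: rec1_comp2 rec2_sub. Qed.
Lemma rec1_succ_comp f : rec1 f -> rec1 (fun x => (f x).+1).
Proof. exact: rec1_comp rec1_succ. Qed.
Lemma rec1_pred_comp f : rec1 f -> rec1 (fun x => (f x).-1).
Proof. exact: rec1_comp rec1_pred. Qed.
Lemma rec1_pi1_comp f : rec1 f -> rec1 (fun x => pi1 (f x)).
Proof. exact: rec1_comp rec1_pi1. Qed.
Lemma rec1_pi2_comp f : rec1 f -> rec1 (fun x => pi2 (f x)).
Proof. exact: rec1_comp rec1_pi2. Qed.

(** * Connectives, bounded sums and quantifiers, arithmetic *)

Lemma rec1_leq f g : rec1 f -> rec1 g -> rec1 (fun x => (f x <= g x : nat)).
Proof.
move=> rf rg; have := rec1_sub (rec1_const 1) (rec1_sub rf rg).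
by apply: rec1_ext => x; rewrite /leq; case: (f x - g x).
Qed.
Lemma rec1_negb (b : nat -> bool) : rec1 (fun x => (b x : nat)) -> rec1 (fun x => (~~ b x : nat)).
Proof.
move=> rb; have := rec1_sub (rec1_const 1) rb.
by apply: rec1_ext => x; case: (b x).
Qed.
Lemma rec1_andb (b c : nat -> bool) : rec1 (fun x => (b x : nat)) -> rec1 (fun x => (c x : nat)) ->
  rec1 (fun x => (b x && c x : nat)).
Proof.
move=> rb rc; have := rec1_mul rb rc.
by apply: rec1_ext => x; case: (b x); case: (c x).
Qed.
Lemma rec1_orb (b c : nat -> bool) : rec1 (fun x => (b x : nat)) -> rec1 (fun x => (c x : nat)) ->
  rec1 (fun x => (b x || c x : nat)).
Proof.
move=> rb rc; have := rec1_negb (rec1_andb (rec1_negb rb) (rec1_negb rc)).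
by apply: rec1_ext => x; rewrite negb_and !negbK.
Qed.
Lemma rec1_eqn f g : rec1 f -> rec1 g -> rec1 (fun x => (f x == g x : nat)).
Proof.
move=> rf rg; have := rec1_andb (rec1_leq rf rg) (rec1_leq rg rf).
by apply: rec1_ext => x; rewrite eqn_leq.
Qed.
Lemma rec1_if (b : nat -> bool) f g : rec1 (fun x => (b x : nat)) -> rec1 f -> rec1 g ->
  rec1 (fun x => if b x then f x else g x).
Proof.
move=> rb rf rg.
have := rec1_add (rec1_mul rb rf) (rec1_mul (rec1_negb rb) rg).
by apply: rec1_ext => x; case: (b x); rewrite ?mul1n ?mul0n ?addn0.
Qed.

Lemma rec1_if_bool (b c d : nat -> bool) :
  rec1 (fun x => (b x : nat)) -> rec1 (fun x => (c x : nat)) ->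
  rec1 (fun x => (d x : nat)) -> rec1 (fun x => ((if b x then c x else d x) : nat)).
Proof. by move=> rb rc rd; apply: rec1_ext (rec1_if rb rc rd) => x; case: (b x). Qed.

Lemma rec1_sum n F : rec1 n -> rec1 (fun z => F (pi1 z) (pi2 z)) ->
  rec1 (fun x => \sum_(i < n x) F x i).
Proof.
move=> rn rF.
have := @rec1_primrec (fun=> 0) (fun x i a => a + F x i) n (rec1_const 0) rn.
have rz : rec1 (fun z => pi2 (pi2 z) + F (pi1 z) (pi1 (pi2 z))).
  apply: rec1_add; first exact: rec1_pi2_comp rec1_pi2.
  apply: (@rec1_comp2 F) rec1_pi1 (rec1_pi1_comp rec1_pi2); exact/rec2P.
move=> /(_ rz); apply: rec1_ext => x.
by elim: (n x) => [|m IH] /=; rewrite ?big_ord0 // big_ord_recr /= IH.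
Qed.

Lemma rec1_prod n F : rec1 n -> rec1 (fun z => F (pi1 z) (pi2 z)) ->
  rec1 (fun x => \prod_(i < n x) F x i).
Proof.
move=> rn rF.
have := @rec1_primrec (fun=> 1) (fun x i a => a * F x i) n (rec1_const 1) rn.
have rz : rec1 (fun z => pi2 (pi2 z) * F (pi1 z) (pi1 (pi2 z))).
  apply: rec1_mul; first exact: rec1_pi2_comp rec1_pi2.
  apply: (@rec1_comp2 F) rec1_pi1 (rec1_pi1_comp rec1_pi2); exact/rec2P.
move=> /(_ rz); apply: rec1_ext => x.
by elim: (n x) => [|m IH] /=; rewrite ?big_ord0 // big_ord_recr /= IH.
Qed.

Lemma rec1_has n (P : nat -> nat -> bool) : rec1 n -> rec1 (fun z => (P (pi1 z) (pi2 z) : nat)) ->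
  rec1 (fun x => (has (P x) (iota 0 (n x)) : nat)).
Proof.
move=> rn rP; have := rec1_leq (rec1_const 1) (@rec1_sum n (fun x i => P x i) rn rP).
apply: rec1_ext => x; rewrite lt0n; congr nat_of_bool; elim: (n x) => [|m IH].
  by rewrite big_ord0.
rewrite big_ord_recr -[in RHS]addn1 iotaD has_cat -IH /= orbF add0n addn_eq0 negb_and eqb0.
by rewrite negbK.
Qed.

Lemma rec1_all n (P : nat -> nat -> bool) : rec1 n -> rec1 (fun z => (P (pi1 z) (pi2 z) : nat)) ->
  rec1 (fun x => (all (P x) (iota 0 (n x)) : nat)).
Proof.
move=> rn rP.
have := rec1_negb (@rec1_has n (fun x i => ~~ P x i) rn (rec1_negb rP)).
by apply: rec1_ext => x; rewrite -all_predC; congr nat_of_bool; apply: eq_all => i; rewrite /= negbK.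
Qed.

Lemma rec1_exp f g : rec1 f -> rec1 g -> rec1 (fun x => f x ^ g x).
Proof.
move=> rf rg; have := @rec1_prod g (fun x _ => f x) rg (rec1_comp rf rec1_pi1).
by apply: rec1_ext => x; rewrite prod_nat_const card_ord.
Qed.

Lemma rec1_fact f : rec1 f -> rec1 (fun x => (f x)`!).
Proof.
move=> rf; have := @rec1_prod f (fun _ i => i.+1) rf (rec1_succ_comp rec1_pi2).
by apply: rec1_ext => x; elim: (f x) => [|n IH]; rewrite ?big_ord0 // big_ord_recr /= IH factS mulnC.
Qed.

(** The quotient counts the positive multiples of [d] up to [e], of which there are at most [e];
    division thus becomes a bounded sum. *)
Lemma divn_sum e d : 0 < d -> e %/ d = \sum_(i < e) (i.+1 * d <= e).
Proof.
move=> d0; under eq_bigr do rewrite -leq_divRL //.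
suff H q n : q <= n -> q = \sum_(i < n) (i < q) by exact: H (leq_div _ _).
elim: n => [|n IH]; first by rewrite big_ord0; case: q.
rewrite big_ord_recr leq_eqVlt => /orP[/eqP->|lt_qn].
  rewrite (eq_bigr (fun=> 1)) => [|i _]; last by rewrite /= (leqW (ltn_ord i)).
  by rewrite sum_nat_const card_ord muln1 /= ltnSn addn1.
by rewrite -IH //= [n < q]ltnNge -ltnS lt_qn addn0.
Qed.

Lemma rec1_divn f g : rec1 f -> rec1 g -> rec1 (fun x => f x %/ g x).
Proof.
(* At a zero divisor the sum would count every index, whereas [%/] returns 0. *)
move=> rf rg; apply: (@rec1_ext (fun x => if g x == 0 then 0 else
   \sum_(i < f x) (i.+1 * g x <= f x))).
  by move=> x; case: (g x) => // d; rewrite divn_sum.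
apply: rec1_if; [exact: rec1_eqn rg (rec1_const 0)|exact: rec1_const|].
apply: (@rec1_sum f (fun x i => i.+1 * g x <= f x) rf).
apply: rec1_leq (rec1_comp rf rec1_pi1).
exact: rec1_mul (rec1_succ_comp rec1_pi2) (rec1_comp rg rec1_pi1).
Qed.

Lemma rec1_modn f g : rec1 f -> rec1 g -> rec1 (fun x => f x %% g x).
Proof.
move=> rf rg; have := rec1_sub rf (rec1_mul (rec1_divn rf rg) rg).
apply: rec1_ext => x; have := divn_eq (f x) (g x); lia.
Qed.

(* Course-of-values recursion: [history G n] codes the list of the values of
   [course G] below n, the most recent value first. *)
Definition history (G : nat -> nat -> nat) n :=
  nat_rect (fun=> nat) 0 (fun i l => pair_code (G i l) l) n.
Definition course G n := G n (history G n).
Definition entry n i l := pi1 (iter (n - i.+1) pi2 l).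

Lemma entry_history G n i : i < n -> entry n i (history G n) = course G i.
Proof.
rewrite /entry /course; elim: n => // n IH; rewrite subSS ltnS leq_eqVlt.
case/orP=> [/eqP->|lt_in]; first by rewrite subnn /= pi1_pair.
have -> : n - i = (n - i.+1).+1 by lia.
by rewrite iterSr /= pi2_pair IH.
Qed.

Lemma rec1_entry f g h : rec1 f -> rec1 g -> rec1 h ->
  rec1 (fun x => entry (f x) (g x) (h x)).
Proof.
move=> rf rg rh; apply: rec1_pi1_comp.
have := @rec1_primrec h (fun _ _ a => pi2 a) (fun x => f x - (g x).+1) rh.
move=> /(_ (rec1_sub rf (rec1_succ_comp rg))).
move=> /(_ (rec1_pi2_comp (rec1_pi2_comp rec1_pi2))).
by apply: rec1_ext => x; elim: (f x - _) => //= n ->.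
Qed.

Lemma rec1_history f G : rec1 f ->
  rec1 (fun z => G (pi1 z) (pi1 (pi2 z)) (pi2 (pi2 z))) ->
  rec1 (fun x => history (G x) (f x)).
Proof.
move=> rf rG; apply: (@rec1_primrec (fun=> 0)
  (fun x i l => pair_code (G x i l) l) f (rec1_const 0) rf).
exact: rec1_pair rG (rec1_pi2_comp rec1_pi2).
Qed.

Lemma rec1_course f G : rec1 f ->
  rec1 (fun z => G (pi1 z) (pi1 (pi2 z)) (pi2 (pi2 z))) ->
  rec1 (fun x => course (G x) (f x)).
Proof.
move=> rf rG.
have := rec1_comp rG (rec1_pair rec1_id (rec1_pair rf (rec1_history rf rG))).
by apply: rec1_ext => x; rewrite !(pi1_pair, pi2_pair).
Qed.

Ltac rec1_step :=
  lazymatch goal with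
  | |- rec1 (fun x => x) => exact: rec1_id
  | |- rec1 (fun _ => ?c) => exact: rec1_const
  | |- rec1 pi1 => exact: rec1_pi1
  | |- rec1 pi2 => exact: rec1_pi2
  | |- rec1 (fun x => pi1 _) => apply: rec1_pi1_comp
  | |- rec1 (fun x => pi2 _) => apply: rec1_pi2_comp
  | |- rec1 (fun x => pair_code _ _) => apply: rec1_pair
  | |- rec1 (fun x => nat_of_bool (~~ _)) => apply: rec1_negb
  | |- rec1 (fun x => nat_of_bool (_ && _)) => apply: rec1_andb
  | |- rec1 (fun x => nat_of_bool (_ || _)) => apply: rec1_orb
  | |- rec1 (fun x => nat_of_bool (_ == _)) => apply: rec1_eqn
  | |- rec1 (fun x => nat_of_bool (_ <= _)) => apply: rec1_leq
  | |- rec1 (fun x => nat_of_bool (if _ then _ else _)) => apply: rec1_if_bool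
  | |- rec1 (fun x => if _ then _ else _) => apply: rec1_if
  | |- rec1 (fun x => _`!) => apply: rec1_fact
  | |- rec1 (fun x => _ ^ _) => apply: rec1_exp
  | |- rec1 (fun x => _ %/ _) => apply: rec1_divn
  | |- rec1 (fun x => _ %% _) => apply: rec1_modn
  | |- rec1 (fun x => entry _ _ _) => apply: rec1_entry
  | |- rec1 (fun x => _ + _) => apply: rec1_add
  | |- rec1 (fun x => _ * _) => apply: rec1_mul
  | |- rec1 (fun x => _ - _) => apply: rec1_sub
  | |- rec1 (fun x => _.-1) => apply: rec1_pred_comp
  | |- rec1 (fun x => _.+1) => apply: rec1_succ_comp
  | |- rec1 (fun x => \sum_(i < _) _) => apply: rec1_sum
  | |- rec1 (fun x => nat_rect _ _ _ _) => apply: rec1_primrec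
  | |- rec1 (fun x => course _ _) => apply: rec1_course
  | |- rec1 (fun x => history _ _) => apply: rec1_history
  | H : rec1 ?f |- rec1 ?f => exact: H
  | H : rec1 ?f |- rec1 (fun x => ?f _) => apply: (rec1_comp H)
  | H : rec2 ?f |- rec1 (fun x => ?f _ _) => apply: (rec1_comp2 H)
  end.
Ltac rec1_auto := repeat rec1_step.

(** * The evaluator on codes of rationals, assignments and formulas *)

(** The number [c] codes [(pos c - neg c) / den c]. The denominator is stored as its predecessor, so
    every number is a code, and 0 codes the rational 0. *)
Definition pos c := pi1 c.
Definition neg c := pi1 (pi2 c).
Definition den c := (pi2 (pi2 c)).+1.
Definition mulc a b :=
  pair_code (pos a * pos b + neg a * neg b)
    (pair_code (pos a * neg b + neg a * pos b) (den a * den b).-1).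
Definition lec a b :=
  pos a * den b + neg b * den a <= pos b * den a + neg a * den b.

(** An assignment is a number in base [B] whose digit at [x] codes the value of variable [x]. *)
Definition digit B e x := e %/ B ^ x %% B.
Definition set_digit V B e x c :=
  \sum_(i < V) (if i == x :> nat then c else digit B e i) * B ^ i.

Definition term_step B e s l :=
  if pi1 s == 0 then digit B e (pi2 s)
  else mulc (entry s (pi1 (pi2 s)) l) (entry s (pi2 (pi2 s)) l).
Definition term_val B e s := course (term_step B e) s.

(** Here [n0] is the code of the whole input. Its variables have indices at most [n0], so
    assignments have [n0.+1] digits. [cb n0 j] is meant to bound the codes of values once the code
    of the current subformula has dropped to [n0 - j]. *)
Definition base (cb : nat -> nat -> nat) n0 := (cb n0 n0.+1).+1.

(** The list [l] holds the tables for all codes below [n], so the truth of a subformula is a lookup.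
    The tags are those of [code]; quantifiers try each code in [dom] as digit [r1]. *)
Definition step_body cb n0 n l e : bool :=
  let B := base cb n0 in let r := pi2 n in let r1 := pi1 r in let r2 := pi2 r in
  let T m e' := entry (B ^ n0.+1) e' (entry n m l) == 1 in
  let t1 := term_val B e r1 in let t2 := term_val B e r2 in
  let T' c := T r2 (set_digit n0.+1 B e r1 c) in
  let dom := iota 0 (cb n0 (n0 - n).+1).+1 in
  if pi1 n == 0 then lec t1 t2 && lec t2 t1 else
  if pi1 n == 1 then lec t1 t2 else
  if pi1 n == 2 then ~~ T r e else
  if pi1 n == 3 then T r1 e && T r2 e else
  if pi1 n == 4 then T r1 e || T r2 e else
  if pi1 n == 5 then ~~ T r1 e || T r2 e else
  if pi1 n == 6 then all T' dom else has T' dom.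

(** Here [history] serves to list the truth values at all assignments, giving the table of [n]. *)
Definition table_step cb n0 n l :=
  history (fun e _ => step_body cb n0 n l e) (base cb n0 ^ n0.+1).
Definition truth cb n0 n e := step_body cb n0 n (history (table_step cb n0) n) e.
Definition decide cb n := nat_of_bool (truth cb n n 0).

Lemma rec1_digit f g h : rec1 f -> rec1 g -> rec1 h ->
  rec1 (fun x => digit (f x) (g x) (h x)).
Proof. by move=> *; rewrite /digit; rec1_auto. Qed.

Lemma rec1_set_digit V B e x c : rec1 V -> rec1 B -> rec1 e -> rec1 x -> rec1 c ->
  rec1 (fun z => set_digit (V z) (B z) (e z) (x z) (c z)).
Proof.
move=> rV rB re rx rc.
apply: (@rec1_sum V
  (fun z i => (if i == x z then c z else digit (B z) (e z) i) * B z ^ i)) => //.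
by rewrite /digit; rec1_auto.
Qed.

Lemma rec1_mulc f g : rec1 f -> rec1 g -> rec1 (fun x => mulc (f x) (g x)).
Proof. by move=> *; rewrite /mulc /pos /neg /den; rec1_auto. Qed.

Lemma rec1_lec f g : rec1 f -> rec1 g -> rec1 (fun x => (lec (f x) (g x) : nat)).
Proof. by move=> *; rewrite /lec /pos /neg /den; rec1_auto. Qed.

Lemma rec1_term_val B e s : rec1 B -> rec1 e -> rec1 s ->
  rec1 (fun z => term_val (B z) (e z) (s z)).
Proof.
move=> rB re rs; apply: (@rec1_course s (fun z => term_step (B z) (e z))) => //.
rewrite /term_step; apply: rec1_if; rec1_auto.
  by apply: rec1_digit; rec1_auto.
by apply: rec1_mulc; rec1_auto.
Qed.

Lemma rec1_base cb n : rec2 cb -> rec1 n -> rec1 (fun z => base cb (n z)).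
Proof. by move=> rcb rn; rewrite /base; rec1_auto. Qed.

Lemma rec1_step_body cb n0 n l e : rec2 cb -> rec1 n0 -> rec1 n -> rec1 l -> rec1 e ->
  rec1 (fun z => (step_body cb (n0 z) (n z) (l z) (e z) : nat)).
Proof.
move=> rcb rn0 rn rl re.
pose T n0 n l m e' := entry (base cb n0 ^ n0.+1) e' (entry n m l) == 1.
have rT n0' n' l' m e' : rec1 n0' -> rec1 n' -> rec1 l' -> rec1 m -> rec1 e' ->
    rec1 (fun z => (T (n0' z) (n' z) (l' z) (m z) (e' z) : nat)).
  by move=> *; rewrite /T; rec1_auto; apply: rec1_base.
have rt f : rec1 f -> rec1 (fun z => term_val (base cb (n0 z)) (e z) (f z)).
  by move=> rf; apply: rec1_term_val => //; apply: rec1_base.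
have rdom : rec1 (fun z => (cb (n0 z) (n0 z - n z).+1).+1).
  by rec1_auto.
have rT' : rec1 (fun z => (T (n0 (pi1 z)) (n (pi1 z)) (l (pi1 z)) (pi2 (pi2 (n (pi1 z))))
    (set_digit (n0 (pi1 z)).+1 (base cb (n0 (pi1 z))) (e (pi1 z))
       (pi1 (pi2 (n (pi1 z)))) (pi2 z)) : nat)).
  apply: rT; rec1_auto.
  apply: rec1_set_digit; rec1_auto.
  by apply: rec1_base => //; rec1_auto.
pose T' z c := T (n0 z) (n z) (l z) (pi2 (pi2 (n z)))
    (set_digit (n0 z).+1 (base cb (n0 z)) (e z) (pi1 (pi2 (n z))) c).
have rall := @rec1_all _ T' rdom rT'.
have rhas := @rec1_has _ T' rdom rT'.
rewrite /step_body; cbv zeta.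
rec1_auto; try exact: rall; try exact: rhas;
  try (by apply: rec1_lec; apply: (rt); rec1_auto); by apply: rec1_base; rec1_auto.
Qed.

Lemma rec1_decide cb : rec2 cb -> rec1 (decide cb).
Proof.
move=> rcb; rewrite /decide /truth.
apply: rec1_step_body => //; [exact: rec1_id|exact: rec1_id| |exact: rec1_const].
apply: (@rec1_history id (table_step cb)); first exact: rec1_id.
rewrite /table_step.
apply: (@rec1_history (fun z => base cb (pi1 z) ^ (pi1 z).+1)
  (fun z e _ => step_body cb (pi1 z) (pi1 (pi2 z)) (pi2 (pi2 z)) e)).
  by rec1_auto; apply: rec1_base; rec1_auto.
by apply: rec1_step_body; rec1_auto.
Qed.

(** * Automorphisms of the group of positive rationals *)

Import Order.TTheory GRing.Theory Num.Theory.
Local Open Scope ring_scope.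

(** * Fractions and p-adic valuations *)

Lemma pos_ratP (x : rat) : 0 < x ->
  exists m n : nat, [/\ (0 < m)%N, (0 < n)%N, coprime m n & x = m%:R / n%:R].
Proof.
move=> x0; exists `|numq x|%N, `|denq x|%N; split.
- by rewrite absz_gt0 numq_eq0 gt_eqF.
- by rewrite absz_gt0 denq_neq0.
- exact: coprime_num_den.
by rewrite !natr_absz !ger0_norm ?numq_ge0 ?denq_ge0 ?ltW // divq_num_den.
Qed.

Lemma frac_eq (m n m' n' : nat) : (0 < n)%N -> (0 < n')%N ->
  (m%:R / n%:R = m'%:R / n'%:R :> rat) <-> (m * n' = m' * n)%N.
Proof.
move=> n0 n'0; have nz k : (0 < k)%N -> k%:R != 0 :> rat by rewrite pnatr_eq0 -lt0n.
split=> [/eqP|e]; last by apply/eqP; rewrite eqr_div ?nz // -!natrM e.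
by rewrite eqr_div ?nz // -!natrM eqr_nat => /eqP.
Qed.

Definition pval (p : nat) (x : rat) : int :=
  (logn p `|numq x|)%:Z - (logn p `|denq x|)%:Z.

Lemma val_frac p (m n : nat) : (0 < m)%N -> (0 < n)%N ->
  pval p (m%:R / n%:R) = (logn p m)%:Z - (logn p n)%:Z.
Proof.
move=> m0 n0; rewrite /pval; set x : rat := _ / _.
have x0 : 0 < x by rewrite divr_gt0 ?ltr0n.
have a0 : (0 < `|numq x|)%N by rewrite absz_gt0 numq_eq0 gt_eqF.
have d0 : (0 < `|denq x|)%N by rewrite absz_gt0 denq_neq0.
have : x = (`|numq x|%N)%:R / (`|denq x|%N)%:R.
  by rewrite !natr_absz !ger0_norm ?numq_ge0 ?denq_ge0 ?ltW // divq_num_den.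
rewrite {1}/x => /frac_eq -/(_ n0 d0) /(congr1 (logn p)); rewrite !lognM //; lia.
Qed.

Lemma val_nat p m : (0 < m)%N -> pval p m%:R = (logn p m)%:Z.
Proof. by move=> m0; have := @val_frac p m 1 m0 isT; rewrite divr1 logn1 subr0. Qed.

Lemma valM p x y : 0 < x -> 0 < y -> pval p (x * y) = pval p x + pval p y.
Proof.
move=> /pos_ratP[m [n [m0 n0 _ ->]]] /pos_ratP[m' [n' [m'0 n'0 _ ->]]].
rewrite mulf_div -!natrM !val_frac ?muln_gt0 ?m0 ?n0 // !lognM //; lia.
Qed.

Lemma val1 p : pval p 1 = 0.
Proof. by rewrite (@val_nat p 1) // logn1. Qed.

Lemma valX p x (k : nat) : 0 < x -> pval p (x ^+ k) = k%:Z * pval p x.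
Proof.
move=> x0; elim: k => [|k IH]; first by rewrite expr0 val1 mul0r.
by rewrite exprS valM ?exprn_gt0 // IH intS mulrDl mul1r.
Qed.

Lemma valV p x : 0 < x -> pval p x^-1 = - pval p x.
Proof.
move=> x0; apply/eqP; rewrite -addr_eq0 addrC -valM ?invr_gt0 //.
by rewrite divff ?lt0r_neq0 // val1.
Qed.

Lemma valXz p x (k : int) : 0 < x -> pval p (x ^ k) = k * pval p x.
Proof.
move=> x0; case: k => k; first by rewrite -exprnP valX.
by rewrite NegzE -exprnN valV ?exprn_gt0 // valX // mulNr.
Qed.

(** Endomorphisms of the multiplicative group of positive rationals, encoded as total functions on
    [rat] with arbitrary values elsewhere. *)
Definition pos_morph (f : rat -> rat) :=
  (forall x, 0 < x -> 0 < f x) /\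
  (forall x y, 0 < x -> 0 < y -> f (x * y) = f x * f y).

Definition pos_aut f := pos_morph f /\
  exists2 g, pos_morph g & forall x, 0 < x -> g (f x) = x /\ f (g x) = x.

Lemma pos_morph_comp f g : pos_morph f -> pos_morph g -> pos_morph (f \o g).
Proof.
move=> [f0 fM] [g0 gM]; split=> [x x0|x y x0 y0] /=; first exact/f0/g0.
by rewrite gM // fM // g0.
Qed.

Lemma pos_aut_id : pos_aut id.
Proof. by split=> //; exists id. Qed.

Lemma pos_aut_comp f g : pos_aut f -> pos_aut g -> pos_aut (f \o g).
Proof.
move=> [mf [f' mf' ff']] [mg [g' mg' gg']]; split; first exact: pos_morph_comp.
exists (g' \o f'); first exact: pos_morph_comp.
move=> x x0 /=; have gx0 := (mg.1 _ x0); have fx0 := (mf'.1 _ x0).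
by rewrite (ff' _ gx0).1 (gg' _ x0).1 (gg' _ fx0).2 (ff' _ x0).2.
Qed.

Lemma pos_morph1 f : pos_morph f -> f 1 = 1.
Proof.
move=> [f0 fM]; have f1 : 0 < f 1 by exact: f0.
apply: (mulfI (lt0r_neq0 f1)); by rewrite -fM // !mulr1.
Qed.

Lemma pos_morphX f x k : pos_morph f -> 0 < x -> f (x ^+ k) = f x ^+ k.
Proof.
move=> mf x0; elim: k => [|k IH]; first by rewrite !expr0 pos_morph1.
by rewrite !exprS mf.2 ?exprn_gt0 // IH.
Qed.

Lemma pos_morphV f x : pos_morph f -> 0 < x -> f x^-1 = (f x)^-1.
Proof.
move=> mf x0; have fx0 := lt0r_neq0 (mf.1 _ x0).
apply: (mulfI fx0); rewrite -mf.2 ?invr_gt0 // !divff ?pos_morph1 //.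
exact: lt0r_neq0.
Qed.

(** For distinct primes, an elementary transvection in the basis of primes: it sends [q] to
    [q * p ^ s] and fixes all other primes. *)
Definition transvection p q (s : int) (x : rat) := x * p%:R ^ (s * pval q x).

Lemma transvection_morph p q s : prime p -> pos_morph (transvection p q s).
Proof.
move=> pp; have p0 : 0 < p%:R :> rat by rewrite ltr0n prime_gt0.
split=> [x x0|x y x0 y0]; first by rewrite mulr_gt0 // exprz_gt0.
rewrite /transvection valM // mulrDr expfzDr ?lt0r_neq0 //; ring.
Qed.

(** Multiplying by a power of [p] leaves the [q]-adic valuation unchanged, so the opposite parameter
    undoes the map. *)
Lemma transvectionK p q s x : prime p -> prime q -> p != q -> 0 < x ->
  transvection p q (- s) (transvection p q s x) = x.
Proof.
move=> pp pq npq x0; have p0 : 0 < p%:R :> rat by rewrite ltr0n prime_gt0.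
rewrite /transvection valM ?exprz_gt0 // valXz // val_nat ?prime_gt0 //.
rewrite logn_prime // eq_sym (negPf npq) mulr0 addr0 -mulrA -expfzDr ?lt0r_neq0 //.
by rewrite mulNr subrr mulr1.
Qed.

Lemma transvection_aut p q s : prime p -> prime q -> p != q ->
  pos_aut (transvection p q s).
Proof.
move=> pp pq npq; split; first exact: transvection_morph.
exists (transvection p q (- s)); first exact: transvection_morph.
move=> x x0; rewrite transvectionK //; split=> //.
by rewrite -{1}[s]opprK transvectionK.
Qed.

Definition smooth H x := forall p, prime p -> (H < p)%N -> pval p x = 0.

Lemma transvection_smooth H p q s x : prime q -> (H < q)%N -> smooth H x ->
  transvection p q s x = x.
Proof. by move=> pq Hq /(_ q pq Hq) e; rewrite /transvection e mulr0 mulr1. Qed.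
(* Euclid's algorithm on the exponents, carried out by transvections. *)
Lemma gather_primes H q0 r : prime q0 -> (H < q0)%N -> (0 < r)%N ->
  (forall p, prime p -> (p %| r)%N -> (H < p)%N) ->
  exists2 f, pos_aut f & (forall x, 0 < x -> smooth H x -> f x = x) /\
    exists g : nat, f r%:R = q0%:R ^+ g.
Proof.
move=> pq0 Hq0; have [n] := ubnP r; elim: n r => // n IH r; rewrite ltnS => rn r0 Hr.
(* One subtraction of Euclid's algorithm: the transvection divides [r] by [p ^ logn q r], and
   induction handles the smaller quotient. Smooth rationals stay fixed because [H < q]. *)
have step p q : prime p -> prime q -> p != q -> (q %| r)%N ->
    (logn q r <= logn p r)%N -> exists2 f, pos_aut f &
    (forall x, 0 < x -> smooth H x -> f x = x) /\ exists g : nat, f r%:R = q0%:R ^+ g.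
  move=> pp pq npq qr le_qp.
  have y0 : (0 < logn q r)%N by rewrite logn_gt0 mem_primes pq r0.
  have dp : (p ^ logn q r %| r)%N by rewrite pfactor_dvdn.
  have p1 : (1 < p ^ logn q r)%N by rewrite -{1}(expn0 p) ltn_exp2l ?prime_gt1.
  have r'0 : (0 < r %/ p ^ logn q r)%N.
    by rewrite divn_gt0 ?(ltnW p1) //; apply: dvdn_leq.
  have lt_r' : (r %/ p ^ logn q r < n)%N by apply: leq_trans rn; rewrite ltn_Pdiv.
  have [p' pp' dp'|f af [fix_f [g fg]]] := IH _ lt_r' r'0.
    by apply: (Hr _ pp'); rewrite (dvdn_trans dp') ?dvdn_div.
  exists (f \o transvection p q (-1)).
    exact: pos_aut_comp (transvection_aut _ pp pq npq).
  split=> [x x0 sx|]; first by rewrite /= (transvection_smooth _ _ pq (Hr _ pq qr)) ?fix_f.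
  exists g; rewrite -fg /= /transvection val_nat // mulN1r; congr f.
  rewrite -exprz_inv -exprnP exprVn -natrX; apply: (canLR (mulfK _)).
    by rewrite pnatr_eq0 -lt0n expn_gt0 prime_gt0.
  by rewrite -natrM divnK.
have [->|r1] := eqVneq r 1%N.
  by exists id; [exact: pos_aut_id|split=> //; exists 0; rewrite expr0].
have pq : prime (pdiv r) by rewrite pdiv_prime // ltn_neqAle eq_sym r1.
set q := pdiv r in pq *; have qr : (q %| r)%N := pdiv_dvd _.
(* If the part of [r] prime to [q] is nontrivial, it supplies a second prime [p], and the smaller
   exponent is subtracted from the larger. *)
have [m1|m1] := eqVneq (r`_q^')%N 1%N; last first.
  have pp : prime (pdiv (r`_q^')%N) by rewrite pdiv_prime // ltn_neqAle eq_sym m1 part_gt0.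
  set p := pdiv _ in pp; have pr : (p %| r)%N := dvdn_trans (pdiv_dvd _) (dvdn_part _ _).
  have npq : p != q.
    have /pnatP := part_pnat q^' r; move=> /(_ (part_gt0 _ _) p pp (pdiv_dvd _)).
    by rewrite !inE.
  have [le_qp|/ltnW le_pq] := leqP (logn q r) (logn p r); first exact: (step p q).
  by apply: (step q p) => //; rewrite eq_sym.
have rE : r = (q ^ logn q r)%N by rewrite -p_part -{1}(partnC q r0) m1 muln1.
set y := logn q r in rE *.
have [e|nqq0] := eqVneq q q0.
  by exists id; [exact: pos_aut_id|split=> //; exists y; rewrite {1}rE natrX e].
(* This turns [q ^ y] into [q0 ^ y]: the first map yields [q ^ y * q0 ^ y], the second cancels
   [q ^ y]. *)
exists (transvection q q0 (-1) \o transvection q0 q 1).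
  by apply: pos_aut_comp; apply: transvection_aut => //; rewrite eq_sym.
split=> [x x0 sx|] /=.
  by rewrite (transvection_smooth _ _ pq (Hr _ pq qr)) ?(transvection_smooth _ _ pq0 Hq0).
have q'0 : 0 < q0%:R :> rat by rewrite ltr0n prime_gt0.
have q''0 : 0 < q%:R :> rat by rewrite ltr0n prime_gt0.
exists y; rewrite {2}/transvection val_nat // -/y mul1r -exprnP rE natrX.
rewrite /transvection valM ?exprn_gt0 // !valX // !val_nat ?prime_gt0 //.
rewrite !logn_prime // eqxx eq_sym (negPf nqq0) mulr0 add0r mulr1 mulN1r.
by rewrite -exprz_inv -exprnP exprVn mulrAC divff ?mul1r // lt0r_neq0 ?exprn_gt0.
Qed.

(** * Bounded representatives modulo L-th powers *)

Lemma expn_prod I (r : seq I) (F : I -> nat) k :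
  ((\prod_(i <- r) F i) ^ k = \prod_(i <- r) F i ^ k)%N.
Proof. by apply: (big_morph (fun x => x ^ k)%N) => [x y|]; rewrite ?expnMn ?exp1n. Qed.

Lemma smooth_natE H N : [pred p : nat | p <= H]%N.-nat N ->
  N = (\prod_(i < H.+1) i ^ logn i N)%N.
Proof.
move=> sN; rewrite -(big_mkord xpredT (fun i => i ^ logn i N)%N) -{1}(part_pnat_id sN).
rewrite (widen_partn _ (leq_maxl N H)) [RHS](big_nat_widen _ _ (maxn N H).+1) //.
by rewrite ltnS leq_maxr.
Qed.

(** The first factor bounds a product of numbers up to [H] with exponents below [L]; the second
    bounds such a power of a single prime at most $H!+1$. *)
Definition rep_bound H L := (H.+1 ^ (L * H.+1) * H`!.+1 ^ L)%N.

(** Each exponent is divided by [L]: the remainders form [D], the quotients form [z]. *)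
Lemma smooth_rep H L N : (0 < L)%N -> (0 < N)%N ->
  [pred p : nat | p <= H]%N.-nat N ->
  exists D z, [/\ (0 < z)%N, N = (D * z ^ L)%N & (D <= H.+1 ^ (L * H.+1))%N].
Proof.
move=> L0 N0 /smooth_natE NE.
exists (\prod_(i < H.+1) i ^ (logn i N %% L))%N, (\prod_(i < H.+1) i ^ (logn i N %/ L))%N.
have E : N = ((\prod_(i < H.+1) i ^ (logn i N %% L)) *
    (\prod_(i < H.+1) i ^ (logn i N %/ L)) ^ L)%N.
  rewrite {1}NE expn_prod -big_split /=; apply: eq_bigr => i _.
  by rewrite -expnM -expnD addnC -divn_eq.
split=> //.
  rewrite lt0n; apply: contraTneq N0 => z0; by rewrite E z0 exp0n // muln0.
rewrite expnM; have <- : (\prod_(i < H.+1) H.+1 ^ L = (H.+1 ^ L) ^ H.+1)%N.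
  by rewrite prod_nat_const card_ord.
apply: leq_prod => i _.
have := ltnW (ltn_pmod (logn i N) L0); move: (logn i N %% L)%N => k kL.
apply: leq_trans (leq_pexp2l (ltn0Sn H) kL); case: k {kL} => // k.
by rewrite leq_exp2r // ltnW.
Qed.

(** Euclid's argument: a prime factor of $H!+1$ cannot divide $H!$. *)
Lemma prime_above_bound H : exists q, [/\ prime q, (H < q)%N & (q <= H`!.+1)%N].
Proof.
have pq : prime (pdiv H`!.+1) by rewrite pdiv_prime // ltnS fact_gt0.
exists (pdiv H`!.+1); split=> //; last exact: pdiv_leq.
rewrite ltnNge; apply/negP => qH; have := pdiv_dvd H`!.+1.
rewrite -[X in (_ %| X)%N]addn1 dvdn_addr ?dvdn_fact ?prime_gt0 // dvdn1 => /eqP e.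
by rewrite e in pq.
Qed.

(** Up to an [L]-th power, [x] is an integer [N]. Its part with primes up to [H] is reduced by
    [smooth_rep]; the rest is gathered into one prime, whose exponent is then reduced modulo [L]. *)
Lemma bounded_rep H L (x : rat) : (0 < L)%N -> 0 < x ->
  exists2 f, pos_aut f & (forall y, 0 < y -> smooth H y -> f y = y) /\
    (exists (D : nat) (z : rat), [/\ (0 < D <= rep_bound H L)%N, 0 < z & f x = D%:R * z ^+ L]).
Proof.
move=> L0 /pos_ratP[m [n [m0 n0 _ xE]]].
(* The denominator is absorbed through [m / n = m * n ^ (L - 1) / n ^ L]. *)
pose N := (m * n ^ L.-1)%N; have N0 : (0 < N)%N by rewrite muln_gt0 m0 expn_gt0 n0.
pose pi := [pred p : nat | p <= H]%N.
have n0' : 0 < n%:R :> rat by rewrite ltr0n.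
have {}xE : x = N%:R / n%:R ^+ L.
  have u0 : 0 < n%:R ^+ L.-1 :> rat by rewrite exprn_gt0.
  rewrite xE /N natrM natrX -[in RHS](prednK L0) exprS /=.
  by move: u0; set u := _ ^+ _ => u0; field; rewrite !lt0r_neq0.
have [q [pq Hq qle]] := prime_above_bound H.
have Hr p : prime p -> (p %| N`_(pi^'))%N -> (H < p)%N.
  move=> pp dp; have /pnatP := part_pnat pi^' N.
  by move=> /(_ (part_gt0 _ _) p pp dp); rewrite !inE -ltnNge.
have [f af [fix_f [g fg]]] := gather_primes pq Hq (part_gt0 _ _) Hr.
have [D [z [z0 NE Dle]]] := smooth_rep L0 (part_gt0 pi N) (part_pnat pi N).
have q0 : (0 < q)%N := prime_gt0 pq.
have mf := af.1.
have N10 : 0 < (N`_pi)%:R :> rat by rewrite ltr0n part_gt0.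
have N20 : 0 < (N`_(pi^'))%:R :> rat by rewrite ltr0n part_gt0.
have D0 : (0 < D)%N by move: (part_gt0 pi N); rewrite NE muln_gt0 => /andP[].
exists f => //; split=> //.
exists (D * q ^ (g %% L))%N, (z%:R * q%:R ^+ (g %/ L) / f n%:R); split.
- rewrite muln_gt0 D0 expn_gt0 q0 /= leq_mul //.
  apply: leq_trans (leq_pexp2l (ltn0Sn _) (ltnW (ltn_pmod g L0))).
  by case: (g %% L)%N => // k; rewrite leq_exp2r.
- by rewrite divr_gt0 ?mf.1 // mulr_gt0 ?exprn_gt0 ?ltr0n.
rewrite xE mf.2 ?invr_gt0 ?exprn_gt0 ?ltr0n // pos_morphV ?exprn_gt0 //.
rewrite pos_morphX // -{1}(partnC pi N0) natrM mf.2 // fg.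
rewrite fix_f // => [|p pp Hp]; last first.
  rewrite val_nat ?part_gt0 // lognE; case: ifP => // /and3P[_ _ dp].
  have /pnatP := part_pnat pi N; move=> /(_ (part_gt0 _ _) p pp dp).
  by rewrite !inE leqNgt Hp.
rewrite NE !natrM !natrX !exprMn exprVn {1}(divn_eq g L) exprD exprM; ring.
Qed.
(** * Heights and density *)

(** The fraction need not be reduced and is nonnegative; signs are treated separately. *)
Definition height_le (B : nat) (x : rat) :=
  exists m n : nat, [/\ (m <= B)%N, (0 < n <= B)%N & x = m%:R / n%:R].

Lemma height_leW B B' x : (B <= B')%N -> height_le B x -> height_le B' x.
Proof.
move=> BB' [m [n [mB /andP[n0 nB] ->]]]; exists m, n.
by rewrite n0 !(leq_trans _ BB').
Qed.

Lemma height_le_ge0 B x : height_le B x -> 0 <= x.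
Proof. by move=> [m [n [_ _ ->]]]; rewrite divr_ge0. Qed.

Lemma height_leM B B' x y : height_le B x -> height_le B' y -> height_le (B * B') (x * y).
Proof.
move=> [m [n [mB /andP[n0 nB] ->]]] [m' [n' [m'B /andP[n'0 n'B] ->]]].
by exists (m * m')%N, (n * n')%N; rewrite mulf_div -!natrM muln_gt0 n0 n'0 !leq_mul.
Qed.

Lemma height_leV B x : 0 < x -> height_le B x -> height_le B x^-1.
Proof.
move=> + [m [n [mB /andP[n0 nB] xE]]]; rewrite {}xE => x0.
exists n, m; split=> //; last by rewrite invf_div.
by rewrite mB andbT lt0n; apply: contraTneq x0 => ->; rewrite mul0r.
Qed.

Lemma height_leX B x k : height_le B x -> height_le (B ^ k) (x ^+ k).
Proof.
move=> Bx; elim: k => [|k IH]; first by exists 1%N, 1%N.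
by rewrite exprS expnS; apply: height_leM.
Qed.

Lemma height_le_prod n B (F : 'I_n -> rat) : (forall i, height_le B (F i)) ->
  height_le (B ^ n) (\prod_(i < n) F i).
Proof.
elim: n F => [|n IH] F BF; first by exists 1%N, 1%N; rewrite big_ord0.
by rewrite big_ord_recl expnS; apply: height_leM => //; apply: IH.
Qed.

Lemma height_le_nat B m : (0 < B)%N -> (m <= B)%N -> height_le B m%:R.
Proof. by move=> B0 mB; exists m, 1%N; rewrite divr1. Qed.

(** A power of a reduced fraction is reduced, so [m ^ k] and [n ^ k] divide the numerator and
    denominator of any other representation. *)
Lemma height_le_root B x k : (0 < k)%N -> 0 < x -> height_le B (x ^+ k) -> height_le B x.
Proof.
move=> k0 /pos_ratP[m [n [m0 n0 co ->]]] [p [q [pB /andP[q0 qB] e]]].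
move: e; rewrite expr_div_n -!natrX frac_eq ?expn_gt0 ?n0 // => e.
have k1 i : (0 < i)%N -> (i <= i ^ k)%N by move=> i0; rewrite -{1}[i]expn1 leq_pexp2l.
have p0 : (0 < p)%N.
  rewrite lt0n; apply: contraTneq m0 => p0; move/eqP: e; rewrite p0 mul0n.
  by rewrite muln_eq0 expn_eq0 (gtn_eqF q0) orbF k0 andbT => /eqP->.
have cok : coprime (m ^ k) (n ^ k) by rewrite coprimeXl ?coprimeXr.
have dm : (m ^ k %| p)%N by rewrite -(Gauss_dvdl _ cok) -e dvdn_mulr.
have dn : (n ^ k %| q)%N by rewrite -(Gauss_dvdr _ (etrans (coprime_sym _ _) cok)) e dvdn_mull.
exists m, n; rewrite n0; split=> //.
  by apply: leq_trans (k1 _ m0) (leq_trans (dvdn_leq p0 dm) pB).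
by apply: leq_trans (k1 _ n0) (leq_trans (dvdn_leq q0 dn) qB).
Qed.

Lemma height_le_smooth H x : 0 < x -> height_le H x -> smooth H x.
Proof.
move=> x0 [m [n [mH /andP[n0 nH] xE]]] p pp Hp.
have m0 : (0 < m)%N by rewrite lt0n; apply: contraTneq x0 => m0; rewrite xE m0 mul0r.
have l0 i : (0 < i <= H)%N -> logn p i = 0%N.
  move=> /andP[i0 iH]; rewrite lognE; case: ifP => // /and3P[_ _ /(dvdn_leq i0)].
  by rewrite leqNgt (leq_ltn_trans iH Hp).
by rewrite xE val_frac // !l0 ?m0 ?n0.
Qed.

(** A discrete mean value estimate, controlling the spacing of powers of fractions with a common
    denominator. *)
Lemma expn_succ_le j N : (j.+1 ^ N.+1 <= j ^ N.+1 + N.+1 * j.+1 ^ N)%N.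
Proof.
elim: N => [|N IH]; first by rewrite !expn1 expn0; lia.
rewrite expnS (leq_trans (leq_mul (leqnn _) IH)) //.
have : (j ^ N.+1 <= j.+1 ^ N.+1)%N by rewrite leq_exp2r.
rewrite [(j ^ N.+2)%N]expnS; move: (j ^ N.+1)%N => a.
by rewrite [(j.+1 ^ N.+1)%N]expnS; move: (j.+1 ^ N)%N => b; nia.
Qed.

(** A denominator so fine that [N]-th powers of consecutive multiples of its inverse, up to [2 * B],
    differ by less than [1 / B ^ 2]. *)
Definition mesh N B := (N * (2 * B) ^ N.-1 * B ^ 2).+1.

(** With [D] the mesh, the least [i] such that [(i / D) ^ N] exceeds [a] works: the preceding power
    is at most [a], and one step is shorter than the gap between distinct rationals of height at
    most [B]. *)
Lemma power_dense N B a b : (0 < N)%N -> height_le B a -> height_le B b -> a < b ->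
  exists y, [/\ 0 < y, a < y ^+ N < b & height_le (2 * B * mesh N B) y].
Proof.
move=> N0 Ba Bb lt_ab; have a0 := height_le_ge0 Ba.
have B0 : (0 < B)%N by case: Ba => m [n [_ /andP[n0 /(leq_trans n0)]]].
have B0' : 0 < B%:R :> rat by rewrite ltr0n.
have gap : a + (B%:R ^+ 2)^-1 <= b.
  move: Ba Bb lt_ab => [m [n [_ /andP[n0 nB] ->]]] [m' [n' [_ /andP[n'0 n'B] ->]]].
  have n0' : 0 < n%:R :> rat by rewrite ltr0n.
  have n'0' : 0 < n'%:R :> rat by rewrite ltr0n.
  rewrite ltr_pdivrMr // mulrAC ltr_pdivlMr // -!natrM ltr_nat => lt.
  apply: (@le_trans _ _ (m%:R / n%:R + (n%:R * n'%:R)^-1)).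
    rewrite lerD2l lef_pV2 ?posrE ?mulr_gt0 ?exprn_gt0 // expr2.
    by rewrite -!natrM ler_nat leq_mul.
  have -> : m%:R / n%:R + (n%:R * n'%:R)^-1 = (m * n' + 1)%:R / (n * n')%:R :> rat.
    by rewrite natrD !natrM; field; rewrite !lt0r_neq0.
  rewrite ler_pdivrMr ?ltr0n ?muln_gt0 ?n0 // mulrAC ler_pdivlMr // -!natrM ler_nat.
  nia.
set D := mesh N B; have D0 : 0 < D%:R :> rat by rewrite ltr0n.
(* This bounds the least numerator: [2 * B * D] already qualifies, as [a <= B < (2 * B) ^ N]. *)
have top : a < ((2 * B * D)%:R / D%:R) ^+ N.
  rewrite natrM mulfK ?lt0r_neq0 //.
  have aB : a <= B%:R.
    case: Ba => m [n [mB /andP[n0 _] ->]]; rewrite ler_pdivrMr ?ltr0n //.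
    by rewrite -natrM ler_nat; nia.
  apply: (le_lt_trans aB); rewrite -natrX ltr_nat.
  apply: (@leq_trans (2 * B)); first lia.
  by rewrite -{1}[(2 * B)%N]expn1 leq_pexp2l // muln_gt0.
have ex : exists i : nat, a < (i%:R / D%:R) ^+ N by exists (2 * B * D)%N.
case: (ex_minnP ex) => i ai mini; have iB := mini _ top.
case: i => [|j] in ai mini iB *.
  by move: ai; rewrite mul0r expr0n gtn_eqF //= ltNge a0.
exists (j.+1%:R / D%:R); split; first by rewrite divr_gt0 ?ltr0n.
  rewrite ai /=; apply: lt_le_trans gap.
  have ja : (j%:R / D%:R) ^+ N <= a.
    by rewrite leNgt; apply/negP => /mini; rewrite ltnn.
  rewrite -(prednK N0) /= in ja *; move: ja; set M := N.-1 => ja.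
  have := expn_succ_le j M; rewrite -(ler_nat rat) natrD natrM => le.
  have : (j.+1 ^ M <= (2 * B * D) ^ M)%N by case: (M) => // k; rewrite leq_exp2r.
  rewrite -(ler_nat rat) expnMn => le2.
  have DM : 0 < D%:R ^+ M.+1 :> rat by rewrite exprn_gt0.
  rewrite expr_div_n ltr_pdivrMr //.
  rewrite expr_div_n ler_pdivrMr // in ja.
  rewrite -[j.+1%:R ^+ _]natrX mulrDl; apply: (le_lt_trans le); rewrite ler_ltD //.
    by rewrite natrX.
  apply: (@le_lt_trans _ _ (M.+1%:R * ((2 * B) ^ M * D ^ M)%:R)).
    by rewrite ler_wpM2l.
  rewrite ltr_pdivlMl ?exprn_gt0 // -!natrX -!natrM ltr_nat.
  have -> : (B ^ 2 * (M.+1 * ((2 * B) ^ M * D ^ M)) = D.-1 * D ^ M)%N.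
    have -> : D.-1 = (M.+1 * (2 * B) ^ M * B ^ 2)%N by rewrite /M prednK.
    by move: (B ^ 2)%N ((2 * B) ^ M)%N (D ^ M)%N => u v w; ring.
  by rewrite expnS ltn_mul2r expn_gt0 /=.
exists j.+1, D; split=> //=; rewrite leq_pmull // muln_gt0 B0 //.
Qed.

(** The endpoints are the largest lower value and the least upper value. An empty lower part is
    replaced by 0, an empty upper part by [a + 1], which accounts for the factor 2. *)
Lemma cut_bounds (T : finType) (lo : pred T) (F : T -> rat) B : (0 < B)%N ->
  (forall t, 0 < F t) -> (forall t, height_le B (F t)) ->
  (forall t t', lo t -> ~~ lo t' -> F t < F t') ->
  exists a b, [/\ a < b, height_le (2 * B) a, height_le (2 * B) b,
    forall t, lo t -> F t <= a & forall t, ~~ lo t -> b <= F t].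
Proof.
move=> B0 F0 FB sep; have BB : (B <= 2 * B)%N by rewrite leq_pmull.
have [a [Ba lea lta]] : exists a, [/\ height_le B a, forall t, lo t -> F t <= a &
    forall t, ~~ lo t -> a < F t].
  case: (pickP lo) => [t0 lo0|no].
    case: (arg_maxP F lo0) => t lot maxt; exists (F t); split=> // t' lo'.
    exact: sep.
  by exists 0; split=> // [|t]; [exact: (@height_le_nat B 0)|rewrite no].
case: (pickP (fun t => ~~ lo t)) => [t0 lo0|no].
  case: (arg_minP (P := fun t => ~~ lo t) F lo0) => t lot mint; exists a, (F t).
  by split=> //; [exact: lta|exact: height_leW Ba|exact: height_leW (FB _)].
exists a, (a + 1); split=> //; first by rewrite ltrDl.
- exact: height_leW Ba.
- case: Ba => m [n [mB /andP[n0 nB] ->]]; exists (m + n)%N, n.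
  have n0' : n%:R != 0 :> rat by rewrite pnatr_eq0 -lt0n.
  rewrite n0 natrD mulrDl divff // mul2n -addnn leq_add //; split=> //.
  by rewrite (leq_trans nB) ?leq_addr.
- by move=> t; rewrite no.
Qed.

(** * Back and forth *)

Definition monomial V (a : nat -> rat) (u : nat -> nat) := \prod_(i < V) a i ^+ u i.

Definition same_order V M (a b : nat -> rat) :=
  forall u v : nat -> nat, (forall i, u i <= M)%N -> (forall i, v i <= M)%N ->
  (monomial V a u <= monomial V a v) = (monomial V b u <= monomial V b v).

Definition same_powers V L (a b : nat -> rat) :=
  exists2 f, pos_aut f &
  forall i, (i < V)%N -> exists2 z, 0 < z & f (a i) = b i * z ^+ L.

Lemma monomial_gt0 V (a : nat -> rat) u : (forall i, 0 < a i) -> 0 < monomial V a u.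
Proof. by move=> a0; apply: prodr_gt0 => i _; rewrite exprn_gt0. Qed.

Lemma monomialD V a u v :
  monomial V a (fun i => (u i + v i)%N) = monomial V a u * monomial V a v.
Proof. by rewrite /monomial -big_split; apply: eq_bigr => i _; rewrite exprD. Qed.

Lemma monomialX V a u k : monomial V a (fun i => (k * u i)%N) = monomial V a u ^+ k.
Proof. by rewrite /monomial -prodrXl; apply: eq_bigr => i _; rewrite mulnC exprM. Qed.

Lemma eq_monomial V a b u v :
  (forall i, (i < V)%N -> a i ^+ u i = b i ^+ v i) -> monomial V a u = monomial V b v.
Proof. by move=> e; apply: eq_bigr => i _; rewrite e. Qed.

(** Setting a variable to 1 expresses that monomials do not involve it. *)
Lemma monomial_update1 V a x u :
  monomial V (update a x 1) u = monomial V a (update u x 0%N).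
Proof.
by apply: eq_monomial => i _; rewrite /update; case: eqP; rewrite ?expr1n ?expr0.
Qed.

Lemma monomial_update V a x c u : (x < V)%N ->
  monomial V (update a x c) u = c ^+ u x * monomial V (update a x 1) u.
Proof.
move=> xV; rewrite /monomial (bigD1 (Ordinal xV)) // [in RHS](bigD1 (Ordinal xV)) //=.
rewrite {1}/update {2}/update eqxx expr1n mul1r; congr (_ * _).
by apply: eq_bigr => i; rewrite -val_eqE /= => /negPf xi; rewrite /update xi.
Qed.

Lemma update_gt0 (a : nat -> rat) x c :
  (forall i, 0 < a i) -> 0 < c -> forall i, 0 < update a x c i.
Proof. by move=> a0 c0 i; rewrite /update; case: eqP. Qed.

Lemma same_order_update1 V M a b x :
  same_order V M a b -> same_order V M (update a x 1) (update b x 1).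
Proof.
move=> ab u v uM vM; rewrite !monomial_update1; apply: ab => i;
  by rewrite /update; case: eqP.
Qed.

Lemma same_orderW V M M' a b : (M <= M')%N -> same_order V M' a b -> same_order V M a b.
Proof. by move=> MM ab u v uM vM; apply: ab => i; apply: leq_trans MM. Qed.

Lemma ler_exp_cancel (c p q : rat) (w w' : nat) : 0 < c -> (w <= w')%N ->
  (c ^+ w * p <= c ^+ w' * q) = (p <= c ^+ (w' - w) * q) /\
  (c ^+ w' * q <= c ^+ w * p) = (c ^+ (w' - w) * q <= p).
Proof.
move=> c0 ww; rewrite -{1 3}(subnKC ww) exprD -mulrA.
by rewrite !ler_pM2l ?exprn_gt0.
Qed.

(* A comparison of c^w p with q for 0 < w <= M becomes one of c^K p^(K/w) with
   q^(K/w), so the position of the single power c^K decides all of them. *)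
Lemma same_order_update V M K a b x c d : (x < V)%N -> (0 < K)%N ->
  (forall w, (0 < w <= M)%N -> (w %| K)%N) ->
  (forall i, 0 < a i) -> (forall i, 0 < b i) -> 0 < c -> 0 < d ->
  let a1 := update a x 1 in let b1 := update b x 1 in
  same_order V (K * M) a1 b1 ->
  (forall u v, (forall i, u i <= K * M)%N -> (forall i, v i <= K * M)%N ->
    (c ^+ K * monomial V a1 u <= monomial V a1 v) =
      (d ^+ K * monomial V b1 u <= monomial V b1 v) /\
    (monomial V a1 v <= c ^+ K * monomial V a1 u) =
      (monomial V b1 v <= d ^+ K * monomial V b1 u)) ->
  same_order V M (update a x c) (update b x d).
Proof.
move=> xV K0 dvK a0 b0 c0 d0 a1 b1 ab1 cd u v uM vM.
have KM : (M <= K * M)%N by rewrite leq_pmull.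
have a10 := update_gt0 x a0 (@ltr01 rat); have b10 := update_gt0 x b0 (@ltr01 rat).
have ma w : 0 < monomial V a1 w by exact: monomial_gt0.
have mb w : 0 < monomial V b1 w by exact: monomial_gt0.
have key u' v' w : (forall i, u' i <= M)%N -> (forall i, v' i <= M)%N ->
    (0 < w <= M)%N ->
    (c ^+ w * monomial V a1 u' <= monomial V a1 v') =
      (d ^+ w * monomial V b1 u' <= monomial V b1 v') /\
    (monomial V a1 v' <= c ^+ w * monomial V a1 u') =
      (monomial V b1 v' <= d ^+ w * monomial V b1 u').
  move=> u'M v'M wM; have wK := dvK _ wM; have [w0 _] := andP wM.
  have k0 : (0 < K %/ w)%N by rewrite divn_gt0 // dvdn_leq.
  have kM (w' : nat -> nat) : (forall i, w' i <= M)%N -> forall i, (K %/ w * w' i <= K * M)%N.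
    by move=> w'M i; rewrite leq_mul // leq_div.
  have pw (e p q : rat) : 0 < e -> 0 < p -> 0 < q ->
      (e ^+ w * p <= q) = (e ^+ K * p ^+ (K %/ w) <= q ^+ (K %/ w)) /\
      (q <= e ^+ w * p) = (q ^+ (K %/ w) <= e ^+ K * p ^+ (K %/ w)).
    move=> e0 p0 q0; rewrite (_ : e ^+ K = (e ^+ w) ^+ (K %/ w)) -?exprMn; last first.
      by rewrite -exprM mulnC divnK.
    by rewrite !ler_pXn2r // nnegrE ?mulr_ge0 ?exprn_ge0 // ltW.
  rewrite !(pw _ _ _ _ _ _).1 // !(pw _ _ _ _ _ _).2 // -!monomialX.
  by apply: cd; apply: kM.
rewrite !(@monomial_update V a x c) // !(@monomial_update V b x d) // -/a1 -/b1.
(* The smaller exponent of [c] cancels. The remaining one is either 0, where [ab1] applies, or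
   between 1 and [M], where [key] applies. *)
have [uv|vu] := leqP (u x) (v x).
  rewrite !(ler_exp_cancel _ _ _ uv).1 //.
  have [e|e] := posnP (v x - u x).
    by rewrite e !expr0 !mul1r; apply: ab1 => i; apply: leq_trans KM.
  by apply: (key v u _ _ _ _).2 => //; rewrite e (leq_trans (leq_subr _ _)).
rewrite !(ler_exp_cancel _ _ _ (ltnW vu)).2 //.
by apply: (key u v _ _ _ _).1 => //; rewrite subn_gt0 vu (leq_trans (leq_subr _ _)).
Qed.
Lemma same_powers_update V L L' (a b : nat -> rat) x c d f : pos_aut f -> (forall i, 0 < b i) ->
  (forall i, (i < V)%N -> exists2 z, 0 < z & f (a i) = b i * z ^+ (L' * L)%N) ->
  (exists2 z, 0 < z & f c = d * z ^+ L) ->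
  same_powers V L (update a x c) (update b x d).
Proof.
move=> af b0 fa fc; exists f => // i iV; rewrite /update; case: eqP => // _.
by have [z z0 ->] := fa i iV; exists (z ^+ L'); rewrite ?exprn_gt0 // exprM.
Qed.

Lemma morph_monomial V L (a b : nat -> rat) f u : pos_aut f -> (forall i, 0 < a i) ->
  (forall i, (i < V)%N -> exists2 z, 0 < z & f (a i) = b i * z ^+ L) ->
  exists2 z, 0 < z & f (monomial V a u) = monomial V b u * z ^+ L.
Proof.
move=> [mf _] a0 fa; elim: V fa => [|V IH] fa.
  by exists 1 => //; rewrite /monomial !big_ord0 pos_morph1 // expr1n mulr1.
have [i iV|z z0 e] := IH; first exact/fa/ltnW.
have [w w0 e'] := fa V (ltnSn V); exists (z * w ^+ u V); first by rewrite mulr_gt0 ?exprn_gt0.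
rewrite /monomial !big_ord_recr /= -!/(monomial V _ u) mf.2 ?exprn_gt0 //; last exact: monomial_gt0.
by rewrite e (pos_morphX _ mf) // e' !exprMn -!exprM [(u V * L)%N]mulnC; ring.
Qed.

Lemma height_le_monomial V H N (b : nat -> rat) u : (0 < H)%N -> (forall i, (i < V)%N -> height_le H (b i)) ->
  (forall i, u i <= N)%N -> height_le ((H ^ N) ^ V) (monomial V b u).
Proof.
move=> H0 Hb uN; apply: height_le_prod => i.
apply: height_leW (height_leX (u i) (Hb i (ltn_ord i))).
by case: H H0 {Hb} => // H _; rewrite leq_pexp2l.
Qed.

(* The exponents of both monomials compared in [same_order] and the modulus of
   [same_powers] that have to be controlled before a quantifier is removed. *)
Definition order_level M := (2 * (M`! * M))%N.
Definition power_level M L := (M`! * L)%N.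

(** Height of a quotient of two monomials with exponents at most $M! \cdot M$ in numbers of height
    at most [H]. *)
Definition cut_height V M H := ((H ^ (M`! * M)) ^ V * (H ^ (M`! * M)) ^ V)%N.
(** The summand [Q] serves the dependent case. Otherwise the witness is [D * y ^ L] with [D <= R],
    where [B] bounds the endpoints between which [power_dense] places a power of [y]. *)
Definition witness_bound V M L H :=
  let Q := cut_height V M H in let R := rep_bound H L in
  let B := (2 * Q * R ^ M`!)%N in
  (Q + R * (2 * B * mesh (L * M`!) B) ^ L)%N.

Section Forth.

Variables (V M L H : nat) (a b : nat -> rat) (x : nat) (c : rat).
Hypotheses (xV : (x < V)%N) (L0 : (0 < L)%N).
Hypotheses (a0 : forall i, 0 < a i) (b0 : forall i, 0 < b i) (c0 : 0 < c).
Hypothesis Hb : forall i, (i < V)%N -> height_le H (b i).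
Hypothesis ab : same_order V (order_level M) a b.

Let K := M`!.
Let N := (K * M)%N.
Let a1 := update a x 1.
Let b1 := update b x 1.
Let P u := monomial V a1 u.
Let Q u := monomial V b1 u.

Let K0 : (0 < K)%N := fact_gt0 M.
Let P0 u : 0 < P u.
Proof. exact/monomial_gt0/update_gt0. Qed.
Let Q0 u : 0 < Q u.
Proof. exact/monomial_gt0/update_gt0. Qed.

Let ab1 : same_order V (2 * N) a1 b1.
Proof. exact: same_order_update1. Qed.

Let H0 : (0 < H)%N.
Proof. by have [m [n [_ /andP[n0 nB] _]]] := Hb xV; apply: leq_trans nB. Qed.

Let height_Q u v : (forall i, u i <= N)%N -> (forall i, v i <= N)%N ->
  height_le (cut_height V M H) (Q v / Q u).
Proof.
move=> uN vN; have Hb1 i : (i < V)%N -> height_le H (b1 i).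
  by move=> iV; rewrite /b1 /update; case: eqP => _; [apply: (@height_le_nat H 1)|exact: Hb].
by apply: height_leM; [|apply: height_leV => //]; exact: height_le_monomial.
Qed.

(** Comparing two quotients of monomials means cross-multiplying, which adds exponents; hence the
    factor 2 in [order_level]. *)
Let sum_le (u v : nat -> nat) : (forall i, u i <= N)%N -> (forall i, v i <= N)%N ->
  forall i, (u i + v i <= 2 * N)%N.
Proof. by move=> uN vN i; rewrite mul2n -addnn leq_add. Qed.

Let close_order d : 0 < d ->
  (forall u v, (forall i, u i <= N)%N -> (forall i, v i <= N)%N ->
    (c ^+ K * P u <= P v) = (d ^+ K * Q u <= Q v) /\
    (P v <= c ^+ K * P u) = (Q v <= d ^+ K * Q u)) ->
  same_order V M (update a x c) (update b x d).
Proof.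
move=> d0 cd; apply: (same_order_update xV K0) => //.
- by move=> w wM; rewrite dvdn_fact.
- by apply: same_orderW ab1; rewrite leq_pmull.
Qed.

(** The [K]-th power of [d] is made equal to [Q v0 / Q u0]. This bounds the height of [d] and
    reduces every comparison with [d ^ K] to one of monomials. *)
Let dependent_case u0 v0 f : (forall i, u0 i <= N)%N -> (forall i, v0 i <= N)%N ->
  c ^+ K * P u0 = P v0 -> pos_aut f ->
  (forall i, (i < V)%N -> exists2 z, 0 < z & f (a i) = b i * z ^+ power_level M L) ->
  exists d, [/\ 0 < d, height_le (witness_bound V M L H) d,
    same_order V M (update a x c) (update b x d) &
    same_powers V L (update a x c) (update b x d)].
Proof.
move=> u0N v0N e af fa; have mf := af.1.
have fa1 i : (i < V)%N -> exists2 z, 0 < z & f (a1 i) = b1 i * z ^+ power_level M L.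
  move=> iV; rewrite /a1 /b1 /update; case: eqP => _; last exact: fa.
  by exists 1; rewrite ?pos_morph1 // expr1n mulr1.
have a10 := update_gt0 x a0 (@ltr01 rat).
have [z z0 fu] : exists2 z, 0 < z & f (P u0) = Q u0 * z ^+ power_level M L.
  exact: morph_monomial.
have [w w0 fv] : exists2 z, 0 < z & f (P v0) = Q v0 * z ^+ power_level M L.
  exact: morph_monomial.
have wz0 : 0 < z / w by rewrite divr_gt0.
(* Applying [f] to [e] gives [f c ^ K * Q u0 * z ^ (K * L) = Q v0 * w ^ (K * L)]; the factor
   [(z / w) ^ L] absorbs both powers. *)
exists (f c * (z / w) ^+ L).
have fc0 : 0 < f c by exact: mf.1.
have d0 : 0 < f c * (z / w) ^+ L by rewrite mulr_gt0 ?exprn_gt0.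
have dK : (f c * (z / w) ^+ L) ^+ K = Q v0 / Q u0.
  apply: (canRL (mulfK (lt0r_neq0 (Q0 u0)))).
  have := congr1 f e; rewrite mf.2 ?exprn_gt0 // (pos_morphX _ mf) // fu fv => e'.
  have w0' : 0 < w ^+ power_level M L by rewrite exprn_gt0.
  apply: (mulIf (lt0r_neq0 w0')); rewrite -e' exprMn -exprM [(L * K)%N]mulnC -/(power_level M L).
  by rewrite expr_div_n; field; rewrite lt0r_neq0.
split=> //.
- apply: (height_le_root K0) => //; rewrite dK.
  by apply: height_leW (height_Q u0N v0N); rewrite leq_addr.
- apply: close_order => // u v uN vN; rewrite dK.
  have eP : c ^+ K = P v0 / P u0 by apply: (canRL (mulfK (lt0r_neq0 (P0 u0)))).
  rewrite eP ![_ / _ * _]mulrAC !ler_pdivrMr // !ler_pdivlMr // /P /Q -!monomialD.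
  by split; apply: ab1; apply: sum_le.
- apply: (same_powers_update (L' := K) _ af) => //.
  exists (w / z); first by rewrite divr_gt0.
  by rewrite -mulrA -exprMn mulf_div [w * z]mulrC divff ?expr1n ?mulr1 // mulf_neq0 ?lt0r_neq0.
Qed.

(** Bounded exponent vectors as a finite type, extended by 0 beyond [V]: the case distinction
    becomes decidable and the cut has extremal elements. *)
Let exponents (t : {ffun 'I_V -> 'I_N.+1}) i : nat :=
  if insub i is Some j then val (t j) else 0%N.

Let exponents_le t i : (exponents t i <= N)%N.
Proof. by rewrite /exponents; case: insub => // j; rewrite -ltnS ltn_ord. Qed.

Let exponents_ex u : (forall i, u i <= N)%N ->
  exists t, forall e, monomial V e u = monomial V e (exponents t).
Proof.
move=> uN; exists [ffun i : 'I_V => inord (u i)] => e; apply: eq_monomial => i iV.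
by rewrite /exponents insubT ffunE /= inordK ?ltnS.
Qed.

(** No bounded quotient of monomials equals [c ^ K], so all comparisons are strict, and [d ^ K] only
    has to lie in the open interval left by a finite cut. *)
Let independent_case f :
  (forall u v, (forall i, u i <= N)%N -> (forall i, v i <= N)%N -> c ^+ K * P u != P v) ->
  pos_aut f ->
  (forall i, (i < V)%N -> exists2 z, 0 < z & f (a i) = b i * z ^+ power_level M L) ->
  exists d, [/\ 0 < d, height_le (witness_bound V M L H) d,
    same_order V M (update a x c) (update b x d) &
    same_powers V L (update a x c) (update b x d)].
Proof.
move=> indep af fa; have mf := af.1.
have [g ag [fix_g [D [z0 [/andP[D0 DR] z00 gc]]]]] := bounded_rep H L0 (mf.1 _ c0).
have D0' : 0 < D%:R :> rat by rewrite ltr0n.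
pose T := ({ffun 'I_V -> 'I_N.+1} * {ffun 'I_V -> 'I_N.+1})%type.
pose lo (t : T) := P (exponents t.2) < c ^+ K * P (exponents t.1).
pose F (t : T) := Q (exponents t.2) / Q (exponents t.1).
have cut0 : (0 < cut_height V M H)%N by rewrite muln_gt0 !expn_gt0 H0.
have F0 t : 0 < F t by rewrite divr_gt0.
have HF t : height_le (cut_height V M H) (F t) by apply: height_Q; apply: exponents_le.
have sep t t' : lo t -> ~~ lo t' -> F t < F t'.
  rewrite /lo /F -leNgt ltr_pdivrMr // mulrAC ltr_pdivlMr // => lt1 le2.
  rewrite ltNge /Q -!monomialD -ab1 => [|i|i]; try by apply: sum_le => j; apply: exponents_le.
  rewrite !monomialD -/(P _) -ltNge.
  apply: lt_le_trans (ler_wpM2r (ltW (P0 _)) le2).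
  by rewrite mulrAC ltr_pM2r.
have [al [be [lt_ab Hal Hbe lo_al be_up]]] := cut_bounds cut0 F0 HF sep.
have DK0 : 0 < D%:R ^+ K :> rat by rewrite exprn_gt0.
have lt_ab' : al / D%:R ^+ K < be / D%:R ^+ K by rewrite ltr_pM2r ?invr_gt0.
have HD : height_le (rep_bound H L) D%:R.
  by apply: height_le_nat => //; apply: leq_trans DR.
have HDK : height_le (rep_bound H L ^ K) (D%:R ^+ K)^-1.
  by apply: height_leV => //; apply: height_leX.
have LK0 : (0 < L * K)%N by rewrite muln_gt0 L0.
have [y [y0 /andP[ly yu] Hy]] := power_dense LK0 (height_leM Hal HDK) (height_leM Hbe HDK) lt_ab'.
have d0 : 0 < D%:R * y ^+ L by rewrite mulr_gt0 ?exprn_gt0.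
have dl : al < (D%:R * y ^+ L) ^+ K by rewrite exprMn -exprM mulrC -ltr_pdivrMr.
have du : (D%:R * y ^+ L) ^+ K < be by rewrite exprMn -exprM mulrC -ltr_pdivlMr.
(* Here [D] carries the class modulo [L]-th powers, and [y ^ L] moves the [K]-th power between [al]
   and [be]. *)
exists (D%:R * y ^+ L); split=> //.
- apply: height_leW (height_leM HD (height_leX L Hy)).
  by rewrite leq_addl.
- apply: close_order => // u v uN vN; set d := _ ^+ K in dl du *.
  have := indep _ _ uN vN.
  have [[t2 et2] [t1 et1]] := (exponents_ex vN, exponents_ex uN).
  rewrite /P /Q et1 et2 et1 et2 -!/(P _) -!/(Q _) => ne.
  have [lo12|up12] := boolP (lo (t1, t2)).
    have lt : Q (exponents t2) < d * Q (exponents t1).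
      by rewrite -ltr_pdivrMr //; apply: le_lt_trans dl; apply: (lo_al (t1, t2)).
    have lo' : P (exponents t2) < c ^+ K * P (exponents t1) := lo12.
    by rewrite (ltW lt) (ltW lo') !leNgt lo' lt.
  have lt : d * Q (exponents t1) < Q (exponents t2).
    by rewrite -ltr_pdivlMr //; apply: lt_le_trans du _; apply: (be_up (t1, t2)).
  have lt' : c ^+ K * P (exponents t1) < P (exponents t2).
    by rewrite lt_neqAle ne leNgt.
  by rewrite (ltW lt) (ltW lt') !leNgt lt' lt.
- apply: (same_powers_update (L' := K) _ (pos_aut_comp ag af)) => //= [i iV|].
    (* The map [g] fixes the [H]-smooth [b i], so the relation for [f] passes to [g \o f]. *)
    have [z z1 ->] := fa i iV; exists (g z); first exact: ag.1.1.
    rewrite ag.1.2 ?exprn_gt0 // (pos_morphX _ ag.1) // (fix_g (b i)) //.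
    by apply: height_le_smooth => //; apply: Hb.
  exists (z0 / y); first by rewrite divr_gt0.
  by rewrite gc expr_div_n; field; rewrite expf_neq0 ?lt0r_neq0.
Qed.

Lemma forth : same_powers V (power_level M L) a b ->
  exists d, [/\ 0 < d, height_le (witness_bound V M L H) d,
    same_order V M (update a x c) (update b x d) &
    same_powers V L (update a x c) (update b x d)].
Proof.
move=> [f af fa].
have [/existsP[t1 /existsP[t2 /eqP e]]|no] :=
  boolP [exists t1, exists t2, c ^+ K * P (exponents t1) == P (exponents t2)].
  by apply: dependent_case e af fa => i; apply: exponents_le.
apply: independent_case af fa => u v uN vN.
have [[t2 et2] [t1 et1]] := (exponents_ex vN, exponents_ex uN).
apply: contraNneq no; rewrite /P et1 et2 => e.
by apply/existsP; exists t1; apply/existsP; exists t2; apply/eqP.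
Qed.

End Forth.

(** * Similarity of assignments with signs and zeros *)

(** Zero is replaced by 1 so that only positive rationals reach the group arguments; the sign
    condition in [similar] remembers the zeros. *)
Definition abs1 (x : rat) := if x == 0 then 1 else `|x|.

Lemma abs1_gt0 x : 0 < abs1 x.
Proof. by rewrite /abs1; case: eqP => // /eqP; rewrite normr_gt0. Qed.

Definition similar V M L (a b : nat -> rat) :=
  [/\ forall i, (i < V)%N -> Num.sg (a i) = Num.sg (b i),
      same_order V M (abs1 \o a) (abs1 \o b) &
      same_powers V L (abs1 \o a) (abs1 \o b)].

Lemma same_powers_sym V L (a b : nat -> rat) : (forall i, 0 < a i) -> (forall i, 0 < b i) ->
  same_powers V L a b -> same_powers V L b a.
Proof.
move=> a0 b0 [f [mf [g mg fg]] fa].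
have ag : pos_aut g by split=> //; exists f => // x x0; have [] := fg x x0.
exists g => // i iV; have [z z0 e] := fa i iV.
exists (g z)^-1; first by rewrite invr_gt0 mg.1.
have := congr1 g e; rewrite (fg _ (a0 i)).1 mg.2 ?exprn_gt0 // (pos_morphX _ mg) // => ->.
by rewrite exprVn mulfK // expf_neq0 // lt0r_neq0 // mg.1.
Qed.

Lemma similar_sym V M L a b : similar V M L a b -> similar V M L b a.
Proof.
move=> [sg ord pw]; split=> [i iV|u v uM vM|]; first by rewrite sg.
  by rewrite ord.
by apply: same_powers_sym pw => i; apply: abs1_gt0.
Qed.

Lemma similar_refl V M L a : similar V M L a a.
Proof.
split=> //; exists id; first exact: pos_aut_id.
by move=> i _; exists 1; rewrite // expr1n mulr1.
Qed.

Lemma similarW V M M' L L' a b : (M <= M')%N -> (L %| L')%N ->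
  similar V M' L' a b -> similar V M L a b.
Proof.
move=> MM /dvdnP[k ->] [sg ord [f af fa]]; split=> //; first exact: same_orderW ord.
exists f => // i iV; have [z z0 ->] := fa i iV.
by exists (z ^+ k); rewrite ?exprn_gt0 // exprM.
Qed.

Lemma eq_similar V M L a b b' : (forall i, (i < V)%N -> b i = b' i) ->
  similar V M L a b -> similar V M L a b'.
Proof.
move=> e [sg ord [f af fa]]; split=> [i iV|u v uM vM|]; first by rewrite sg ?e.
  rewrite ord //; congr (_ <= _); apply: eq_monomial => i iV /=; by rewrite e.
by exists f => // i iV; rewrite /= -e //; apply: fa.
Qed.

Lemma abs1_update a x c : abs1 \o update a x c = update (abs1 \o a) x (abs1 c).
Proof. by apply: functional_extensionality => i; rewrite /= /update; case: eqP. Qed.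

(** A zero [c] is answered by 0; otherwise the positive answer to [|c|] receives the sign of [c]. *)
Lemma similar_forth V M L H (a b : nat -> rat) x c : (x < V)%N -> (0 < L)%N ->
  (forall i, (i < V)%N -> height_le H (abs1 (b i))) ->
  similar V (order_level M) (power_level M L) a b ->
  exists2 d, height_le (witness_bound V M L H) `|d| &
    similar V M L (update a x c) (update b x d).
Proof.
move=> xV L0 Hb [sg ord pw].
have a0 i : 0 < (abs1 \o a) i by exact: abs1_gt0.
have b0 i : 0 < (abs1 \o b) i by exact: abs1_gt0.
have fwd (c' : rat) (c0 : 0 < c') := forth xV L0 a0 b0 c0 Hb ord pw.
have sgd d : Num.sg c = Num.sg d -> forall i, (i < V)%N ->
    Num.sg (update a x c i) = Num.sg (update b x d i).
  by move=> e i iV; rewrite /update; case: eqP => // _; apply: sg.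
have [c0|c0] := eqVneq c 0.
  exists 0.
    (* An auxiliary witness for 1 supplies a positive denominator within the bound, with which 0 is
       written as [0 / n]. *)
    have [d [_ [m [n [mB nB _]]] _ _]] := fwd 1 ltr01.
    by exists 0%N, n; rewrite normr0 mul0r.
  rewrite c0; split; [by rewrite -c0; apply: sgd; rewrite c0| |].
    rewrite !abs1_update /abs1 eqxx; apply: same_order_update1.
    apply: same_orderW ord; rewrite /order_level.
    by rewrite -[leqLHS]mul1n leq_mul // leq_pmull // fact_gt0.
  case: pw => f af fa; rewrite !abs1_update /abs1 eqxx.
  apply: (same_powers_update (L' := M`!) _ af) => //.
  by exists 1; rewrite // (pos_morph1 af.1) expr1n mulr1.
have [|d [d0 Hd ord' pw']] := fwd `|c|; first by rewrite normr_gt0.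
have absd : `|Num.sg c * d| = d by rewrite normrM normr_sg c0 mul1r gtr0_norm.
have abs1d : abs1 (Num.sg c * d) = d.
  by rewrite /abs1 mulf_eq0 sgr_eq0 (negPf c0) gt_eqF //= absd.
have abs1c : abs1 c = `|c| by rewrite /abs1 (negPf c0).
exists (Num.sg c * d); first by rewrite absd.
split; rewrite ?abs1_update ?abs1d ?abs1c //.
by apply: sgd; rewrite sgrM sgr_id (gtr0_sg d0) mulr1.
Qed.

(** No height of [c] has to be tracked here, so [similar_forth] applies with the roles exchanged and
    any common height bound for [a]. *)
Lemma similar_back V M L (a b : nat -> rat) x d : (x < V)%N -> (0 < L)%N ->
  similar V (order_level M) (power_level M L) a b ->
  exists c, similar V M L (update a x c) (update b x d).
Proof.
move=> xV L0 /similar_sym sim.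
have [H Ha] : exists H, forall i, (i < V)%N -> height_le H (abs1 (a i)).
  elim: (V) => [|W [H IH]]; first by exists 0%N.
  have [m [n [m0 n0 _ e]]] := pos_ratP (abs1_gt0 (a W)).
  exists (H + m + n)%N => i; rewrite ltnS leq_eqVlt => /orP[/eqP->|/IH].
    by exists m, n; rewrite n0; split=> //; lia.
  by apply: height_leW; lia.
by have [c _ /similar_sym] := similar_forth d xV L0 Ha sim; exists c.
Qed.

(** * Atomic formulas and dependence on free variables *)

Fixpoint occurrences t i : nat :=
  match t with
  | Var x => i == x
  | Mul t u => (occurrences t i + occurrences u i)%N
  end.

Lemma norm_eval V a t : all (fun x => x < V)%N (term_vars t) ->
  eval (M := rat_mul_le) a t != 0 ->
  `|eval (M := rat_mul_le) a t| = monomial V (abs1 \o a) (occurrences t).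
Proof.
elim: t => [x|t IHt u IHu] /=.
  rewrite andbT => xV ax; rewrite /monomial (bigD1 (Ordinal xV)) //= eqxx expr1.
  rewrite /abs1 (negPf ax) big1 ?mulr1 // => i; rewrite -val_eqE /= => /negPf->.
  by rewrite expr0.
rewrite all_cat => /andP[Vt Vu]; rewrite mulf_eq0 => /norP[t0 u0].
by rewrite monomialD -IHt // -IHu // normrM.
Qed.

Lemma sgr_eval V a b t : all (fun x => x < V)%N (term_vars t) ->
  (forall i, (i < V)%N -> Num.sg (a i) = Num.sg (b i)) ->
  Num.sg (eval (M := rat_mul_le) a t) = Num.sg (eval (M := rat_mul_le) b t).
Proof.
move=> + sg; elim: t => [x|t IHt u IHu] /=; first by rewrite andbT => /sg.
by rewrite all_cat => /andP[Vt Vu]; rewrite !sgrM IHt // IHu.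
Qed.

(** Signs decide unless both numbers are nonzero of the same sign. Absolute values of negative
    numbers compare in reverse, so both directions are assumed. *)
Lemma le_by_sgr (x y x' y' : rat) : Num.sg x = Num.sg x' -> Num.sg y = Num.sg y' ->
  (x != 0 -> y != 0 -> (`|x| <= `|y|) = (`|x'| <= `|y'|) /\ (`|y| <= `|x|) = (`|y'| <= `|x'|)) ->
  (x <= y) = (x' <= y').
Proof.
move=> sx sy h.
have neg z z' : Num.sg z = Num.sg z' -> z < 0 -> z' < 0 :> rat.
  by move=> e; rewrite -sgr_lt0 e sgr_lt0.
have pos z z' : Num.sg z = Num.sg z' -> 0 < z -> 0 < z' :> rat.
  by move=> e; rewrite -sgr_gt0 e sgr_gt0.
have zero z z' : Num.sg z = Num.sg z' -> z = 0 -> z' = 0 :> rat.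
  by move=> e /eqP; rewrite -sgr_eq0 e sgr_eq0 => /eqP.
have [x0|x0|x0] := ltrgtP x 0; have [y0|y0|y0] := ltrgtP y 0.
- have [x'0 y'0] := (neg _ _ sx x0, neg _ _ sy y0).
  have [||_ e] := h; [by rewrite lt_eqF|by rewrite lt_eqF|].
  by rewrite -[x <= y]lerN2 -[x' <= y']lerN2 -!ltr0_norm.
- have [x'0 y'0] := (neg _ _ sx x0, pos _ _ sy y0).
  by rewrite (ltW (lt_trans x0 y0)) (ltW (lt_trans x'0 y'0)).
- by have [x'0 y'0] := (neg _ _ sx x0, zero _ _ sy y0); rewrite y0 y'0 !ltW.
- have [x'0 y'0] := (pos _ _ sx x0, neg _ _ sy y0).
  by rewrite !leNgt (lt_trans y0 x0) (lt_trans y'0 x'0).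
- have [x'0 y'0] := (pos _ _ sx x0, pos _ _ sy y0).
  have [||e _] := h; [by rewrite gt_eqF|by rewrite gt_eqF|].
  by rewrite -[x]gtr0_norm // -[y]gtr0_norm // e !gtr0_norm.
- have [x'0 y'0] := (pos _ _ sx x0, zero _ _ sy y0).
  by rewrite y0 y'0 !leNgt x0 x'0.
- have [x'0 y'0] := (zero _ _ sx x0, neg _ _ sy y0).
  by rewrite x0 x'0 !leNgt y0 y'0.
- by have [x'0 y'0] := (zero _ _ sx x0, pos _ _ sy y0); rewrite x0 x'0 !ltW.
- by have [x'0 y'0] := (zero _ _ sx x0, zero _ _ sy y0); rewrite x0 x'0 y0 y'0.
Qed.

Lemma similar_le V M L a b s t :
  similar V M L a b ->
  all (fun x => x < V)%N (term_vars s) -> all (fun x => x < V)%N (term_vars t) ->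
  (forall i, occurrences s i <= M)%N -> (forall i, occurrences t i <= M)%N ->
  (eval (M := rat_mul_le) a s <= eval (M := rat_mul_le) a t) =
  (eval (M := rat_mul_le) b s <= eval (M := rat_mul_le) b t).
Proof.
move=> [sg ord _] Vs Vt Ms Mt; apply: le_by_sgr => [||s0 t0].
- exact: sgr_eval sg.
- exact: sgr_eval sg.
have s0' : eval (M := rat_mul_le) b s != 0 by rewrite -sgr_eq0 -(sgr_eval Vs sg) sgr_eq0.
have t0' : eval (M := rat_mul_le) b t != 0 by rewrite -sgr_eq0 -(sgr_eval Vt sg) sgr_eq0.
by rewrite !(norm_eval (V := V)) //; split; apply: ord.
Qed.

Lemma holds_ext (M : mul_le_structure) p (e e' : nat -> M) :
  {in free_vars p, e =1 e'} -> holds e p <-> holds e' p.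
Proof.
have ext_t t (d d' : nat -> M) : {in term_vars t, d =1 d'} -> eval d t = eval d' t.
  elim: t d d' => [x|t IHt u IHu] d d' /= dd; first by apply: dd; rewrite inE.
  by rewrite (IHt d d') ?(IHu d d') // => x xi; apply: dd; rewrite mem_cat xi ?orbT.
have split2 (s1 s2 : seq nat) (d d' : nat -> M) : {in s1 ++ s2, d =1 d'} ->
    {in s1, d =1 d'} /\ {in s2, d =1 d'}.
  by move=> dd; split=> x xi; apply: dd; rewrite mem_cat xi ?orbT.
have upd x q (d d' : nat -> M) c : {in [seq y <- free_vars q | y != x], d =1 d'} ->
    {in free_vars q, update d x c =1 update d' x c}.
  move=> dd y yq; rewrite /update; case: eqP => // /eqP yx.
  by apply: dd; rewrite mem_filter yx.
elim: p e e' => [s t|s t|p IHp|p IHp q IHq|p IHp q IHq|p IHp q IHq|x p IHp|x p IHp] e e' /=.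
- by move=> /split2[/ext_t-> /ext_t->].
- by move=> /split2[/ext_t-> /ext_t->].
- by move=> /IHp ->.
- by move=> /split2[/IHp-> /IHq->].
- by move=> /split2[/IHp-> /IHq->].
- by move=> /split2[/IHp-> /IHq->].
- by move=> ee; split=> h c; [rewrite -(IHp _ _ (upd _ _ _ _ c ee))|rewrite (IHp _ _ (upd _ _ _ _ c ee))].
- by move=> ee; split=> -[c h]; exists c; move: h; rewrite (IHp _ _ (upd _ _ _ _ c ee)).
Qed.

(** * Correctness of the evaluator *)

Definition cval (c : nat) : rat := ((pos c)%:R - (neg c)%:R) / (den c)%:R.

Lemma den_neq0 c : (den c)%:R != 0 :> rat.
Proof. by rewrite pnatr_eq0. Qed.

Lemma cval_mulc c d : cval (mulc c d) = cval c * cval d.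
Proof.
have e : den (mulc c d) = (den c * den d)%N.
  by rewrite {1}/den /mulc !pi2_pair prednK // muln_gt0.
rewrite /cval e /pos /neg /mulc !(pi1_pair, pi2_pair) -/(pos _) -/(neg _).
rewrite -/(pos d) -/(neg d) !natrD !natrM; field.
by rewrite !den_neq0.
Qed.

Lemma lecE c d : lec c d = (cval c <= cval d).
Proof.
have c0 : 0 < (den c)%:R :> rat by rewrite ltr0n.
have d0 : 0 < (den d)%:R :> rat by rewrite ltr0n.
rewrite /cval ler_pdivrMr // mulrAC ler_pdivlMr // /lec -(ler_nat rat) !natrD !natrM.
by apply/idP/idP => h; lra.
Qed.

Lemma cval_height C c : (c <= C)%N -> height_le C.+1 (abs1 (cval c)).
Proof.
move=> cC; have := pair_code_ge (pi1 c) (pi2 c); have := pair_code_ge (pi1 (pi2 c)) (pi2 (pi2 c)).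
rewrite !pair_pi -/(pos c) -/(neg c) => h1 h2.
rewrite /abs1; case: eqP => _; first exact: (@height_le_nat _ 1).
have dC : (0 < den c <= C.+1)%N by rewrite /den; lia.
have d0 : 0 < (den c)%:R :> rat by rewrite ltr0n.
rewrite /cval normrM normfV (gtr0_norm d0).
have [le|/ltnW le] := leqP (neg c) (pos c).
  exists (pos c - neg c)%N, (den c); rewrite dC -natrB // normr_nat; split=> //; lia.
exists (neg c - pos c)%N, (den c); rewrite dC distrC -natrB // normr_nat; split=> //; lia.
Qed.

(** The bound of [pair_code_le] iterated twice, for the nested pairs in a code. *)
Definition code_bound B := (4 * (4 * B.+1 ^ 2).+1 ^ 2)%N.

Lemma cval_surj B x : height_le B `|x| -> exists2 c, (c <= code_bound B)%N & cval c = x.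
Proof.
move=> [m [n [mB /andP[n0 nB] e]]].
have B2 : (B <= 4 * B.+1 ^ 2)%N by rewrite -mulnn; nia.
have bnd p q : (p <= B)%N -> (q <= B)%N ->
    (pair_code p (pair_code q n.-1) <= code_bound B)%N.
  move=> pB qB; apply: pair_code_le; first exact: leq_trans B2.
  by apply: pair_code_le => //; lia.
have [x0|x0] := leP 0 x.
  exists (pair_code m (pair_code 0 n.-1)); first exact: bnd.
  rewrite /cval /pos /neg /den !(pi1_pair, pi2_pair) prednK // subr0 -e ger0_norm //.
exists (pair_code 0 (pair_code m n.-1)); first exact: bnd.
rewrite /cval /pos /neg /den !(pi1_pair, pi2_pair) prednK // sub0r mulNr -e ltr0_norm //.
by rewrite opprK.
Qed.

Lemma digits V B (d : nat -> nat) : (0 < B)%N -> (forall i, d i < B)%N ->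
  (\sum_(i < V) d i * B ^ i < B ^ V)%N /\
  forall i, (i < V)%N -> digit B (\sum_(i < V) d i * B ^ i) i = d i.
Proof.
move=> B0 dB; elim: V => [|V [lt IH]]; first by rewrite big_ord0.
rewrite big_ord_recr /=; set S := (\sum_(_ < _) _)%N in lt IH *; split.
  by rewrite expnS; have := dB V; nia.
move=> i; rewrite ltnS leq_eqVlt => /orP[/eqP->|iV].
  by rewrite /digit addnC divnMDl ?expn_gt0 ?B0 // divn_small // addn0 modn_small.
rewrite -[in RHS]IH // /digit.
have -> : (d V * B ^ V = (d V * B ^ (V - i.+1) * B) * B ^ i)%N.
  by rewrite -!mulnA -!expnS -expnD; congr (_ * _ ^ _)%N; lia.
by rewrite addnC divnMDl ?expn_gt0 ?B0 // modnMDl.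
Qed.

Lemma set_digitP V B e x c : (0 < B)%N -> (c < B)%N -> (x < V)%N ->
  (set_digit V B e x c < B ^ V)%N /\
  forall i, (i < V)%N ->
    digit B (set_digit V B e x c) i = if i == x then c else digit B e i.
Proof.
move=> B0 cB xV; apply: digits => // i; case: ifP => // _.
by rewrite /digit ltn_mod.
Qed.

(** A positive tag makes the inequalities strict, so tables and term values of components are
    available when a compound is reached. *)
Lemma pair_code_gt k x y :
  (x < pair_code k.+1 (pair_code x y))%N /\ (y < pair_code k.+1 (pair_code x y))%N.
Proof. by have := pair_code_ge k.+1 (pair_code x y); have := pair_code_ge x y; lia. Qed.

Definition decode B e i := cval (digit B e i).

Lemma term_valE B e t :
  cval (term_val B e (term_code t)) = eval (M := rat_mul_le) (decode B e) t.
Proof.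
elim: t => [x|t IHt u IHu] /=; rewrite /term_val /course /term_step !(pi1_pair, pi2_pair) //=.
have [tl ul] := pair_code_gt 0 (term_code t) (term_code u).
by rewrite cval_mulc !entry_history // IHt IHu.
Qed.

Lemma entry_table cb n0 n m e : (m < n)%N -> (e < base cb n0 ^ n0.+1)%N ->
  entry (base cb n0 ^ n0.+1) e (entry n m (history (table_step cb n0) n)) =
  truth cb n0 m e.
Proof. by move=> mn eE; rewrite entry_history // /course /table_step entry_history. Qed.

(** * Similarity levels and code bounds along a formula *)

(** Levels are indexed by formula codes: each passage to a subformula lowers the code, so the code
    bounds the quantifiers still to be removed. *)
Definition order_levels n := nat_rect (fun=> nat) 1%N (fun _ M => order_level M) n.
Definition power_levels n :=
  nat_rect (fun=> nat) 1%N (fun i L => power_level (order_levels i) L) n.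
(** Index [j] belongs to subformula code [n0 - j], whose quantifier leaves level [(n0 - j).-1].
    Codes up to [h] have height at most [h.+1]; adding [h] keeps the sequence monotone. *)
Definition code_bounds n0 j :=
  nat_rect (fun=> nat) 0%N (fun j h =>
    (h + code_bound (witness_bound n0.+1 (order_levels (n0 - j).-1)
                       (power_levels (n0 - j).-1) h.+1))%N) j.

Lemma order_levels_ge n : (n < order_levels n)%N.
Proof. by elim: n => //= n IH; rewrite /order_level; have := fact_gt0 (order_levels n); nia. Qed.

Lemma power_levels_gt0 n : (0 < power_levels n)%N.
Proof. by elim: n => //= n IH; rewrite muln_gt0 fact_gt0. Qed.

(** Codes of subformulas may drop by more than one, so levels have to be skipped. *)
Lemma similar_levels V n m a b : (m <= n)%N ->
  similar V (order_levels n) (power_levels n) a b ->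
  similar V (order_levels m) (power_levels m) a b.
Proof.
elim: n => [|n IH]; first by rewrite leqn0 => /eqP->.
rewrite leq_eqVlt => /orP[/eqP->//|mn] /= sim; apply: IH => //.
apply: similarW sim; last by rewrite dvdn_mull.
by rewrite /order_level -[leqLHS]mul1n leq_mul // leq_pmull // fact_gt0.
Qed.

Lemma code_bounds_mono n0 : {homo code_bounds n0 : i j / (i <= j)%N}.
Proof. by apply: homo_leq => // [i j k|j]; [exact: leq_trans|rewrite /= leq_addr]. Qed.

(** The successor accounts for [Var 0], which has code 0 and one occurrence. *)
Lemma occurrences_le t i : (occurrences t i <= (term_code t).+1)%N.
Proof.
elim: t => [x|t IHt u IHu] /=; first by case: eqP.
have := pair_code_ge 1%N (pair_code (term_code t) (term_code u)).
have := pair_code_ge (term_code t) (term_code u); lia.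
Qed.

Lemma term_vars_le t V : (term_code t < V)%N -> all (fun x => x < V)%N (term_vars t).
Proof.
elim: t => [x|t IHt u IHu] /= tV; have := pair_code_ge.
  by move=> /(_ 0%N x); rewrite andbT; lia.
move=> ge; have := ge 1%N (pair_code (term_code t) (term_code u)).
have := ge (term_code t) (term_code u) => h1 h2.
by rewrite all_cat IHt ?IHu //; lia.
Qed.

Section Correctness.

Variable n0 : nat.
Let cb := code_bounds.
Let V := n0.+1.
Let B := base cb n0.

(** The invariant of the evaluation at formula code [n]: the tabulated assignment [e] stands in for
    the true assignment [a]. *)
Let admissible n (a : nat -> rat) e :=
  [/\ (e < B ^ V)%N, forall i, (i < V)%N -> (digit B e i <= cb n0 (n0 - n))%N &
      similar V (order_levels n) (power_levels n) a (decode B e)].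

Let admissible_le n m a e : (m <= n)%N -> admissible n a e -> admissible m a e.
Proof.
move=> mn [eE de sim]; split=> //; last exact: similar_levels sim.
by move=> i iV; apply: leq_trans (de i iV) _; apply: code_bounds_mono; lia.
Qed.

Let atom_le n a e s t : admissible n a e -> (n <= n0)%N ->
  (term_code s <= n)%N -> (term_code t <= n)%N ->
  lec (term_val B e (term_code s)) (term_val B e (term_code t)) =
  (eval (M := rat_mul_le) a s <= eval (M := rat_mul_le) a t).
Proof.
move=> [eE de sim] nn0 sn tn; rewrite lecE !term_valE.
symmetry; apply: (similar_le sim).
- by apply: term_vars_le; rewrite ltnS (leq_trans sn).
- by apply: term_vars_le; rewrite ltnS (leq_trans tn).
- by move=> i; have := occurrences_le s i; have := order_levels_ge n; lia.
- by move=> i; have := occurrences_le t i; have := order_levels_ge n; lia.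
Qed.

Let back_and_forth n m a e x : (m < n)%N -> (n <= n0)%N -> (x < V)%N -> admissible n a e ->
  (forall v, exists2 c, (c < (cb n0 (n0 - n).+1).+1)%N &
    admissible m (update a x v) (set_digit V B e x c)) /\
  (forall c, (c < (cb n0 (n0 - n).+1).+1)%N -> exists v,
    admissible m (update a x v) (set_digit V B e x c)).
Proof.
move=> mn nn0 xV [eE de sim].
have adm c v : (c <= cb n0 (n0 - n).+1)%N ->
    similar V (order_levels n.-1) (power_levels n.-1) (update a x v)
      (update (decode B e) x (cval c)) ->
    admissible m (update a x v) (set_digit V B e x c).
  move=> cle simc.
  have cB : (c < B)%N by rewrite /B /base ltnS (leq_trans cle) // code_bounds_mono; lia.
  have [sE sd] := set_digitP e (isT : (0 < B)%N) cB xV.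
  have mn' : (m <= n.-1)%N by lia.
  apply: (admissible_le mn'); split=> //.
    move=> i iV; rewrite sd //; case: eqP => _.
      by apply: leq_trans cle _; apply: code_bounds_mono; lia.
    by apply: leq_trans (de i iV) _; apply: code_bounds_mono; lia.
  apply: eq_similar simc => i iV; rewrite /decode sd // /update; by case: eqP.
have Hb i : (i < V)%N -> height_le (cb n0 (n0 - n)).+1 (abs1 (decode B e i)).
  by move=> iV; apply: cval_height; apply: de.
(* Since [m < n], [n] is a successor, and its levels unfold to the form required by [similar_forth]
   and [similar_back]. *)
case: n => // n in mn nn0 de sim adm Hb *.
split=> [v|c cle].
  have [d Hd simd] := similar_forth v xV (power_levels_gt0 n) Hb sim.
  have [c cle cd] := cval_surj Hd; rewrite -cd in simd.
  have cle' : (c <= cb n0 (n0 - n.+1).+1)%N.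
    (* By [subKn], the level used in [code_bounds] at index [n0 - n.+1] is [n]. *)
    by rewrite /= subKn // (leq_trans cle) // leq_addl.
  by exists c => //; apply: adm.
have [v simv] := similar_back (cval c) xV (power_levels_gt0 n) sim.
by exists v; apply: adm.
Qed.

(** Induction on the formula: [atom_le] settles atoms, and [back_and_forth] lets the codes in [dom]
    replace all rationals at a quantifier. *)
Let truthP p a e : (code p <= n0)%N -> admissible (code p) a e ->
  truth cb n0 (code p) e <-> holds (M := rat_mul_le) a p.
Proof.
have sub k y z : [/\ (y < pair_code k.+1 (pair_code y z))%N,
    (z < pair_code k.+1 (pair_code y z))%N & (z < pair_code k.+1 z)%N].
  have [h1 h2] := pair_code_gt k y z; split=> //.
  by have := pair_code_ge k.+1 z; lia.
have sub0 k y z : (y <= pair_code k (pair_code y z))%N /\ (z <= pair_code k (pair_code y z))%N.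
  by have := pair_code_ge k (pair_code y z); have := pair_code_ge y z; lia.
have lookup n m (d : nat) : (m < n)%N -> (d < B ^ V)%N ->
    entry (B ^ V) d (entry n m (history (table_step cb n0) n)) == 1%N = truth cb n0 m d.
  by move=> mn dE; rewrite entry_table //; case: truth.
elim: p a e => [s t|s t|p IHp|p IHp q IHq|p IHp q IHq|p IHp q IHq|x p IHp|x p IHp] a e;
  rewrite [code _]/= => le_n0 adm; have [eE _ _] := adm;
  rewrite /truth /step_body !(pi1_pair, pi2_pair) -/B -/V; cbn [eqn andb].
- have [sn tn] := sub0 0%N (term_code s) (term_code t).
  rewrite eqxx !(atom_le adm) //=; split=> [/andP[h1 h2]|->]; last by rewrite lexx.
  by apply/eqP; rewrite eq_le h1.
- have [sn tn] := sub0 1%N (term_code s) (term_code t).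
  by rewrite /= (atom_le adm).
- have [_ _ pn] := sub 1%N 0%N (code p); rewrite /= lookup //.
  have := IHp a e (leq_trans (ltnW pn) le_n0) (admissible_le (ltnW pn) adm).
  by case: truth => <-; split=> // /(_ isT).
- have [pn qn _] := sub 2 (code p) (code q); rewrite /= !lookup //.
  rewrite -(IHp a e (leq_trans (ltnW pn) le_n0) (admissible_le (ltnW pn) adm)).
  rewrite -(IHq a e (leq_trans (ltnW qn) le_n0) (admissible_le (ltnW qn) adm)).
  by split=> /andP.
- have [pn qn _] := sub 3 (code p) (code q); rewrite /= !lookup //.
  rewrite -(IHp a e (leq_trans (ltnW pn) le_n0) (admissible_le (ltnW pn) adm)).
  rewrite -(IHq a e (leq_trans (ltnW qn) le_n0) (admissible_le (ltnW qn) adm)).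
  by split=> /orP.
- have [pn qn _] := sub 4 (code p) (code q); rewrite /= !lookup //.
  rewrite -(IHp a e (leq_trans (ltnW pn) le_n0) (admissible_le (ltnW pn) adm)).
  rewrite -(IHq a e (leq_trans (ltnW qn) le_n0) (admissible_le (ltnW qn) adm)).
  by rewrite -implybE; split=> /implyP.
- have [xn pn _] := sub 5 x (code p); have xV := leq_trans xn (leqW le_n0).
  have [forth_ back] := back_and_forth pn le_n0 xV adm.
  have pn0 := leq_trans (ltnW pn) le_n0.
  split=> [/allP h v|h]; last first.
    apply/allP => c; rewrite mem_iota => /back[v adm']; have [dE _ _] := adm'.
    by rewrite lookup //; apply/IHp; [|exact: adm'|exact: h].
  have [c cl adm'] := forth_ v; have [dE _ _] := adm'.
  by have := h c; rewrite mem_iota cl lookup // => /(_ isT); rewrite (IHp _ _ pn0 adm').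
- have [xn pn _] := sub 6 x (code p); have xV := leq_trans xn (leqW le_n0).
  have [forth_ back] := back_and_forth pn le_n0 xV adm.
  have pn0 := leq_trans (ltnW pn) le_n0.
  split=> [/hasP[c]|[v h]].
    rewrite mem_iota => /back[v adm']; have [dE _ _] := adm'.
    by rewrite lookup // (IHp _ _ pn0 adm'); exists v.
  have [c cl adm'] := forth_ v; have [dE _ _] := adm'.
  by apply/hasP; exists c; rewrite ?mem_iota ?cl // lookup // (IHp _ _ pn0 adm').
Qed.

(** All digits of 0 are 0, the code of the rational 0, so the starting assignment decodes to the
    zero assignment. *)
Lemma truth_correct p : code p = n0 ->
  truth cb n0 n0 0 <-> holds (M := rat_mul_le) (fun=> 0) p.
Proof.
move=> e; rewrite -{2}e; apply: truthP; first by rewrite e.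
have d0 i : digit B 0 i = 0%N by rewrite /digit div0n mod0n.
split; first by rewrite expn_gt0.
  by move=> i _; rewrite d0.
apply: eq_similar (similar_refl _ _ _ _) => i _.
by rewrite /decode d0 /cval /pos /neg subrr mul0r.
Qed.

End Correctness.

(** * Recursiveness of the bounds and decidability *)

Lemma rec1_witness_bound f g h k : rec1 f -> rec1 g -> rec1 h -> rec1 k ->
  rec1 (fun x => witness_bound (f x) (g x) (h x) (k x)).
Proof.
move=> rf rg rh rk; rewrite /witness_bound; cbv zeta.
rewrite /mesh /cut_height /rep_bound; rec1_auto.
Qed.

Lemma rec1_order_levels : rec1 order_levels.
Proof.
apply: (@rec1_primrec (fun=> 1%N) (fun _ _ M => order_level M) id); rewrite /order_level;
  rec1_auto.
Qed.

Lemma rec1_power_levels : rec1 power_levels.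
Proof.
have ro := rec1_order_levels.
apply: (@rec1_primrec (fun=> 1%N) (fun _ i L => power_level (order_levels i) L) id);
  rewrite /power_level; rec1_auto.
Qed.

Lemma rec2_code_bounds : rec2 code_bounds.
Proof.
have ro := rec1_order_levels; have rp := rec1_power_levels.
apply/rec2P; apply: (@rec1_primrec (fun=> 0%N) (fun z j h =>
    (h + code_bound (witness_bound (pi1 z).+1 (order_levels (pi1 z - j).-1)
                       (power_levels (pi1 z - j).-1) h.+1))%N) pi2).
- by rec1_auto.
- by rec1_auto.
- by rewrite /code_bound; rec1_auto; apply: rec1_witness_bound; rec1_auto.
Qed.

Theorem mainTheorem4 : decidable_theory (theory rat_mul_le).
Proof.
exists (fun v : 1.-tuple nat => decide code_bounds (thead v)).
split; first exact: (rec1_decide rec2_code_bounds).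
move=> p sp; rewrite theadE /decide.
have := truth_correct (erefl (code p)); case: truth => -[h1 h2]; split=> //.
(* A sentence has no free variables, so truth at the zero assignment is truth at every
   assignment. *)
- by case; split=> // e; apply/holds_ext; [|exact: (h1 isT)]; rewrite sp.
- by move=> [_ /(_ (fun=> 0))] /h2.
Qed.
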